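(* For every $n$, the natural morphism of $\overline{R}$-algebras $\overline{BMW}_n\to BMW_n^+\oplus BMW_n^-$, $s_i\mapsto (s_i,s_i)$, becomes an isomorphism after tensoring over $\overline{R}$ with $\overline{S}'=\overline{S}[(bc-1)^{-1}]$.
   Context: $R=\mathbb{Q}[a,b,c,(abc)^{-1}]$, $x=b+c$, $y=bc$, $S=R[x^{-1}]$, $\overline{R}=R/(a^2-y^2)$, $\overline{S}=S/(a^2-y^2)$, $S_{\pm}=S/(a\mp y)$. $B_n$ is the braid group on $n$ strands with Artin generators $s_1,\dots,s_{n-1}$; $H_n$ is the quotient of $RB_n$ by the relations $(s_i-a)(s_i-b)(s_i-c)=0$. $\widetilde{BMW}_n$ is the quotient of $H_n$ by the two-sided ideal generated by $$\mathcal{R}_i=-y\,s_is_{i+1}^{-1}s_i+y^2s_{i+1}^{-1}s_is_{i+1}^{-1}-s_is_{i+1}s_i-xy^2s_{i+1}^{-2}+x\,s_i^2+y^3s_{i+1}^{-1}s_i^{-1}s_{i+1}^{-1},\quad 1\le i\le n-2,$$ and $\overline{BMW}_n=\widetilde{BMW}_n\otimes_R\overline{R}$. $BMW_n^{\pm}$ is the quotient of $H_n\otimes_R S_{\pm}$ by the two-sided ideal generated by $e_1s_2e_1-e_1$ and $e_1s_2^{-1}e_1-e_1$ (no relation for $n\le 2$), where $e_1=\frac{a s_1^{-1}\pm s_1}{x}\mp 1$. It is an $\overline R$-algebra via $\overline R\to S_\pm$. The images of the $\mathcal{R}_i$ in $BMW_n^{\pm}$ vanish, which gives the natural morphism of the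 statement. *)

(* Defs.v *)
From HB Require Import structures.
From mathcomp Require Import all_boot all_algebra.
From mathcomp Require Import boolp ring.

Set Implicit Arguments.
Unset Strict Implicit.
Unset Printing Implicit Defensive.

Import GRing.Theory.
Local Open Scope ring_scope.
Local Open Scope quotient_scope.

(* Unital associative R-algebras, as rings with a central structure morphism.
   MathComp's algType excludes the zero ring, which would force a
   nontriviality proof into every construction below. *)
HB.mixin Record isPzAlgebra (R : pzRingType) A of GRing.PzRing A := {
  scal : {rmorphism R -> A};
  scalC : forall (r : R) (u : A), GRing.comm (scal r) u
}.

#[short(type="pzAlgType")]
HB.structure Definition PzAlgebra (R : pzRingType) :=
  {A of GRing.PzRing A & isPzAlgebra R A}.

HB.mixin Record isAlgMorphism (R : pzRingType) (A B : pzAlgType R)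
    (f : A -> B) := {
  alg_morphism_scal : forall r : R, f (scal r) = scal r
}.

HB.structure Definition PzAlgMorphism (R : pzRingType) (A B : pzAlgType R) :=
  {f of @GRing.RMorphism A B f & isAlgMorphism R A B f}.

Notation "{ 'pzalg' A -> B }" := (@PzAlgMorphism.type _ A%type B%type)
  (at level 0, A at level 98, B at level 99,
   format "{ 'pzalg'  A  ->  B }") : type_scope.

Section PairAlgebra.
Variables (R : pzRingType) (A B : pzAlgType R).

Definition pair_scal (r : R) : A * B := (scal r, scal r).

Fact pair_scal_zmod_morphism : zmod_morphism pair_scal.
Proof. by move=> r s; congr pair; exact: rmorphB. Qed.
Fact pair_scal_monoid_morphism : monoid_morphism pair_scal.
Proof.
by split=> [|r s]; congr pair; by [exact: rmorph1 | exact: rmorphM].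
Qed.
HB.instance Definition _ :=
  GRing.isZmodMorphism.Build R (A * B)%type pair_scal pair_scal_zmod_morphism.
HB.instance Definition _ := GRing.isMonoidMorphism.Build R (A * B)%type
  pair_scal pair_scal_monoid_morphism.

Fact pair_scalC r (u : A * B) : GRing.comm (pair_scal r) u.
Proof. by congr pair; exact: scalC. Qed.

HB.instance Definition _ := isPzAlgebra.Build R (A * B)%type pair_scalC.

End PairAlgebra.

(* An algebra over B seen as an algebra over R through phi : R -> B. *)
Definition restrict_scalars (R B : pzRingType) (phi : {rmorphism R -> B})
  (A : Type) : Type := A.

Section RestrictScalars.
Variables (R B : pzRingType) (phi : {rmorphism R -> B}) (A : pzAlgType B).
Local Notation resA := (restrict_scalars phi A).

HB.instance Definition _ := GRing.PzRing.on resA.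

Definition restrict_scal : {rmorphism R -> resA} :=
  (scal : {rmorphism B -> A}) \o phi.

Fact restrict_scalC r (u : resA) : GRing.comm (restrict_scal r) u.
Proof. exact: (@scalC B A). Qed.

HB.instance Definition _ := isPzAlgebra.Build R resA restrict_scalC.

End RestrictScalars.

Section IdealQuotient.

Inductive two_sided_ideal (A : pzRingType) (P : A -> Prop) : A -> Prop :=
| Ideal_gen u : P u -> two_sided_ideal P u
| Ideal_0 : two_sided_ideal P 0
| Ideal_add u v :
    two_sided_ideal P u -> two_sided_ideal P v -> two_sided_ideal P (u + v)
| Ideal_mull u v : two_sided_ideal P v -> two_sided_ideal P (u * v)
| Ideal_mulr u v : two_sided_ideal P u -> two_sided_ideal P (u * v).

Variables (A : pzRingType) (P : A -> Prop).

Definition ideal_eq : rel A := fun u v => `[< two_sided_ideal P (u - v) >].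

Lemma ideal_opp u : two_sided_ideal P u -> two_sided_ideal P (- u).
Proof. by move=> Iu; rewrite -mulN1r; exact: Ideal_mull. Qed.

Lemma ideal_eq_refl : reflexive ideal_eq.
Proof. by move=> u; apply/asboolP; rewrite subrr; exact: Ideal_0. Qed.
Lemma ideal_eq_sym : ssrbool.symmetric ideal_eq.
Proof.
by move=> u v; apply/asboolP/asboolP => /ideal_opp; rewrite opprB.
Qed.
Lemma ideal_eq_trans : ssrbool.transitive ideal_eq.
Proof.
move=> v u w /asboolP Iuv /asboolP Ivw; apply/asboolP.
by rewrite -(subrKA v); exact: Ideal_add.
Qed.

Canonical ideal_eq_equiv :=
  EquivRel ideal_eq ideal_eq_refl ideal_eq_sym ideal_eq_trans.

Definition quot : Type := {eq_quot ideal_eq}.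
HB.instance Definition _ := Choice.on quot.

Definition to_quot (u : A) : quot := \pi_({eq_quot ideal_eq}) u.
Definition quot_repr (z : quot) : A := repr (z : {eq_quot ideal_eq}).

Lemma quot_reprK z : to_quot (quot_repr z) = z.
Proof. exact: reprK. Qed.

Lemma to_quotP u v : to_quot u = to_quot v <-> two_sided_ideal P (u - v).
Proof.
by split=> [/eqmodP/asboolP | Iuv]; last by apply/eqmodP/asboolP.
Qed.

Lemma quotW (Q : quot -> Prop) : (forall u, Q (to_quot u)) -> forall z, Q z.
Proof. by move=> Qu z; rewrite -(quot_reprK z). Qed.

Lemma quot_reprP u : two_sided_ideal P (quot_repr (to_quot u) - u).
Proof. by apply/to_quotP; rewrite quot_reprK. Qed.

Definition quot_add (z t : quot) := to_quot (quot_repr z + quot_repr t).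
Definition quot_opp (z : quot) := to_quot (- quot_repr z).
Definition quot_mul (z t : quot) := to_quot (quot_repr z * quot_repr t).

Lemma to_quot_add u v : to_quot (u + v) = quot_add (to_quot u) (to_quot v).
Proof.
apply/esym/to_quotP; rewrite opprD addrACA.
by apply: Ideal_add; exact: quot_reprP.
Qed.
Lemma to_quot_opp u : to_quot (- u) = quot_opp (to_quot u).
Proof.
apply/esym/to_quotP; rewrite -opprD.
by apply: ideal_opp; exact: quot_reprP.
Qed.
Lemma to_quot_mul u v : to_quot (u * v) = quot_mul (to_quot u) (to_quot v).
Proof.
apply/esym/to_quotP.
rewrite -(subrKA (quot_repr (to_quot u) * v)) -mulrBr -mulrBl.
by apply: Ideal_add; [apply: Ideal_mull | apply: Ideal_mulr];
  exact: quot_reprP.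
Qed.

Fact quot_addA : associative quot_add.
Proof.
elim/quotW=> u; elim/quotW=> v; elim/quotW=> w.
by rewrite -!to_quot_add addrA.
Qed.
Fact quot_addC : commutative quot_add.
Proof. by elim/quotW=> u; elim/quotW=> v; rewrite -!to_quot_add addrC. Qed.
Fact quot_add0 : left_id (to_quot 0) quot_add.
Proof. by elim/quotW=> u; rewrite -to_quot_add add0r. Qed.
Fact quot_addN : left_inverse (to_quot 0) quot_opp quot_add.
Proof. by elim/quotW=> u; rewrite -to_quot_opp -to_quot_add addNr. Qed.
Fact quot_mulA : associative quot_mul.
Proof.
elim/quotW=> u; elim/quotW=> v; elim/quotW=> w.
by rewrite -!to_quot_mul mulrA.
Qed.
Fact quot_mul1 : left_id (to_quot 1) quot_mul.
Proof. by elim/quotW=> u; rewrite -to_quot_mul mul1r. Qed.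
Fact quot_mulr1 : right_id (to_quot 1) quot_mul.
Proof. by elim/quotW=> u; rewrite -to_quot_mul mulr1. Qed.
Fact quot_mulDl : left_distributive quot_mul quot_add.
Proof.
elim/quotW=> u; elim/quotW=> v; elim/quotW=> w.
by rewrite -!(to_quot_mul, to_quot_add) mulrDl.
Qed.
Fact quot_mulDr : right_distributive quot_mul quot_add.
Proof.
elim/quotW=> u; elim/quotW=> v; elim/quotW=> w.
by rewrite -!(to_quot_mul, to_quot_add) mulrDr.
Qed.

HB.instance Definition _ := GRing.isPzRing.Build quot
  quot_addA quot_addC quot_add0 quot_addN
  quot_mulA quot_mul1 quot_mulr1 quot_mulDl quot_mulDr.

Fact to_quot_zmod_morphism : zmod_morphism to_quot.
Proof. by move=> u v; rewrite to_quot_add to_quot_opp. Qed.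
Fact to_quot_monoid_morphism : monoid_morphism to_quot.
Proof. by split=> // u v; exact: to_quot_mul. Qed.

HB.instance Definition _ :=
  GRing.isZmodMorphism.Build A quot to_quot to_quot_zmod_morphism.
HB.instance Definition _ :=
  GRing.isMonoidMorphism.Build A quot to_quot to_quot_monoid_morphism.

Section Lift.
Variables (B : pzRingType) (f : {rmorphism A -> B}).
Definition quot_lift (fP : forall u, P u -> f u = 0) (z : quot) : B := f (quot_repr z).

Hypothesis fP : forall u, P u -> f u = 0.
Local Notation lift := (quot_lift fP).

Lemma quot_liftE u : lift (to_quot u) = f u.
Proof.
suff fI v : two_sided_ideal P v -> f v = 0.
  by apply/eqP; rewrite -subr_eq0 -rmorphB fI //; exact: quot_reprP.
elim=> [? /fP // | | ? ? _ fu _ fv | ? ? _ fv | ? ? _ fu].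
- exact: rmorph0.
- by rewrite rmorphD fu fv addr0.
- by rewrite rmorphM fv mulr0.
- by rewrite rmorphM fu mul0r.
Qed.

Fact quot_lift_zmod_morphism : zmod_morphism lift.
Proof.
elim/quotW=> u; elim/quotW=> v.
by rewrite -rmorphB !quot_liftE rmorphB.
Qed.
Fact quot_lift_monoid_morphism : monoid_morphism lift.
Proof.
split; first by rewrite -(rmorph1 to_quot) quot_liftE rmorph1.
by elim/quotW=> u; elim/quotW=> v; rewrite -rmorphM !quot_liftE rmorphM.
Qed.

HB.instance Definition _ :=
  GRing.isZmodMorphism.Build quot B lift quot_lift_zmod_morphism.
HB.instance Definition _ :=
  GRing.isMonoidMorphism.Build quot B lift quot_lift_monoid_morphism.
End Lift.

End IdealQuotient.

Section ComQuotient.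
Variables (A : comPzRingType) (P : A -> Prop).

Fact com_quot_mulC : commutative (@GRing.mul (quot P)).
Proof. by elim/quotW=> u; elim/quotW=> v; rewrite -!rmorphM mulrC. Qed.

HB.instance Definition _ :=
  GRing.PzRing_hasCommutativeMul.Build (quot P) com_quot_mulC.

End ComQuotient.

Section AlgQuotient.
Variables (R : pzRingType) (A : pzAlgType R) (P : A -> Prop).

Definition quot_scal : {rmorphism R -> quot P} := to_quot P \o scal.

Fact quot_scalC r (z : quot P) : GRing.comm (quot_scal r) z.
Proof.
elim/quotW: z => u; rewrite /GRing.comm /quot_scal /= -!rmorphM.
by congr (to_quot P _); exact: scalC.
Qed.

HB.instance Definition _ := isPzAlgebra.Build R (quot P) quot_scalC.

Fact to_quot_scal (r : R) : to_quot P (scal r) = scal r.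
Proof. by []. Qed.

HB.instance Definition _ :=
  isAlgMorphism.Build R A (quot P) (to_quot P) to_quot_scal.

End AlgQuotient.

(* The localization A[f^-1]; the pair (u, k) stands for u / f^k. *)
Section Localization.
Variables (A : comPzRingType) (f : A).

Definition loc_eq : rel (A * nat) := fun p q =>
  `[< exists m, f ^+ m * (f ^+ q.2 * p.1) = f ^+ m * (f ^+ p.2 * q.1) >].

Lemma loc_eq_refl : reflexive loc_eq.
Proof. by move=> p; apply/asboolP; exists 0%N. Qed.
Lemma loc_eq_sym : ssrbool.symmetric loc_eq.
Proof. by move=> p q; apply/asboolP/asboolP => -[m e]; exists m. Qed.
Lemma loc_eq_trans : ssrbool.transitive loc_eq.
Proof.
move=> [v l] [u k] [w j] /asboolP[m /= e1] /asboolP[m' /= e2].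
apply/asboolP; exists (m + m' + l)%N => /=; rewrite !exprD.
have -> : f ^+ m * f ^+ m' * f ^+ l * (f ^+ j * u) =
    f ^+ m' * f ^+ j * (f ^+ m * (f ^+ l * u)) by ring.
rewrite e1.
have -> : f ^+ m' * f ^+ j * (f ^+ m * (f ^+ k * v)) =
    f ^+ m * f ^+ k * (f ^+ m' * (f ^+ j * v)) by ring.
by rewrite e2; ring.
Qed.

Canonical loc_eq_equiv := EquivRel loc_eq loc_eq_refl loc_eq_sym loc_eq_trans.

Definition loc : Type := {eq_quot loc_eq}.
HB.instance Definition _ := Choice.on loc.

Definition frac (u : A) (k : nat) : loc := \pi_({eq_quot loc_eq}) (u, k).
Definition loc_repr (z : loc) : A * nat := repr (z : {eq_quot loc_eq}).
Local Notation num z := (loc_repr z).1.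
Local Notation den z := (loc_repr z).2.

Lemma loc_reprK z : frac (num z) (den z) = z.
Proof. by rewrite /frac -surjective_pairing; exact: reprK. Qed.

Lemma fracP u k v l : frac u k = frac v l <->
  exists m, f ^+ m * (f ^+ l * u) = f ^+ m * (f ^+ k * v).
Proof.
by split=> [/eqmodP/asboolP | e]; last by apply/eqmodP/asboolP.
Qed.

Lemma locW (Q : loc -> Prop) : (forall u k, Q (frac u k)) -> forall z, Q z.
Proof. by move=> Qu z; rewrite -(loc_reprK z). Qed.

Lemma loc_reprP u k : exists m, f ^+ m * (f ^+ k * num (frac u k)) =
  f ^+ m * (f ^+ den (frac u k) * u).
Proof. by apply/fracP; rewrite loc_reprK. Qed.

Definition loc_add (z t : loc) :=
  frac (f ^+ den t * num z + f ^+ den z * num t) (den z + den t).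
Definition loc_opp (z : loc) := frac (- num z) (den z).
Definition loc_mul (z t : loc) := frac (num z * num t) (den z + den t).

Lemma frac_add u k v l :
  loc_add (frac u k) (frac v l) = frac (f ^+ l * u + f ^+ k * v) (k + l).
Proof.
apply/fracP; case: (loc_reprP u k) (loc_reprP v l) => m e [m' e'].
move: (den (frac u k)) (num (frac u k)) e => k' u' e.
move: (den (frac v l)) (num (frac v l)) e' => l' v' e'.
exists (m + m')%N; rewrite !exprD.
transitivity (f ^+ m' * f ^+ l * f ^+ l' * (f ^+ m * (f ^+ k * u')) +
              f ^+ m * f ^+ k * f ^+ k' * (f ^+ m' * (f ^+ l * v'))).
  by ring.
by rewrite e e'; ring.
Qed.

Lemma frac_opp u k : loc_opp (frac u k) = frac (- u) k.
Proof.
apply/fracP; case: (loc_reprP u k) => m e.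
by exists m; rewrite !mulrN e.
Qed.

Lemma frac_mul u k v l :
  loc_mul (frac u k) (frac v l) = frac (u * v) (k + l).
Proof.
apply/fracP; case: (loc_reprP u k) (loc_reprP v l) => m e [m' e'].
move: (den (frac u k)) (num (frac u k)) e => k' u' e.
move: (den (frac v l)) (num (frac v l)) e' => l' v' e'.
exists (m + m')%N; rewrite !exprD.
transitivity ((f ^+ m * (f ^+ k * u')) * (f ^+ m' * (f ^+ l * v'))).
  by ring.
by rewrite e e'; ring.
Qed.

Lemma eq_frac u k v l : f ^+ l * u = f ^+ k * v -> frac u k = frac v l.
Proof. by move=> e; apply/fracP; exists 0%N; rewrite e. Qed.

Fact loc_addA : associative loc_add.
Proof.
elim/locW=> u k; elim/locW=> v l; elim/locW=> w j; rewrite !frac_add.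
by apply: eq_frac; rewrite !exprD; ring.
Qed.
Fact loc_addC : commutative loc_add.
Proof.
elim/locW=> u k; elim/locW=> v l; rewrite !frac_add.
by apply: eq_frac; rewrite !exprD; ring.
Qed.
Fact loc_add0 : left_id (frac 0 0) loc_add.
Proof.
by elim/locW=> u k; rewrite frac_add; apply: eq_frac; rewrite exprD; ring.
Qed.
Fact loc_addN : left_inverse (frac 0 0) loc_opp loc_add.
Proof.
elim/locW=> u k; rewrite frac_opp frac_add.
by apply: eq_frac; rewrite exprD; ring.
Qed.
Fact loc_mulA : associative loc_mul.
Proof.
elim/locW=> u k; elim/locW=> v l; elim/locW=> w j; rewrite !frac_mul.
by rewrite mulrA addnA.
Qed.
Fact loc_mulC : commutative loc_mul.
Proof. by elim/locW=> u k; elim/locW=> v l; rewrite !frac_mul mulrC addnC. Qed.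
Fact loc_mul1 : left_id (frac 1 0) loc_mul.
Proof. by elim/locW=> u k; rewrite frac_mul mul1r. Qed.
Fact loc_mulDl : left_distributive loc_mul loc_add.
Proof.
elim/locW=> u k; elim/locW=> v l; elim/locW=> w j.
rewrite !(frac_mul, frac_add).
by apply: eq_frac; rewrite !exprD; ring.
Qed.

HB.instance Definition _ := GRing.isZmodule.Build loc
  loc_addA loc_addC loc_add0 loc_addN.
HB.instance Definition _ := GRing.Zmodule_isComPzRing.Build loc
  loc_mulA loc_mulC loc_mul1 loc_mulDl.

Definition to_loc (u : A) : loc := frac u 0.

Fact to_loc_zmod_morphism : zmod_morphism to_loc.
Proof.
move=> u v; apply/esym; rewrite /to_loc.
rewrite -[LHS]/(loc_add _ (loc_opp _)) frac_opp frac_add.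
by apply: eq_frac; ring.
Qed.
Fact to_loc_monoid_morphism : monoid_morphism to_loc.
Proof. by split=> // u v; apply/esym; exact: frac_mul. Qed.

HB.instance Definition _ :=
  GRing.isZmodMorphism.Build A loc to_loc to_loc_zmod_morphism.
HB.instance Definition _ :=
  GRing.isMonoidMorphism.Build A loc to_loc to_loc_monoid_morphism.

Definition loc_inv : loc := frac 1 1.

Lemma loc_invP : to_loc f * loc_inv = 1.
Proof. by rewrite -[LHS]/(loc_mul _ _) frac_mul; apply: eq_frac; ring. Qed.

End Localization.

(* Words in T modulo the congruence generated by the relations E. *)
Section PresentedMonoid.
Variables (T : choiceType) (E : seq T -> seq T -> Prop).

Inductive conv : seq T -> seq T -> Prop :=
| Conv_rel s t : E s t -> conv s t
| Conv_refl s : conv s s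
| Conv_sym s t : conv s t -> conv t s
| Conv_trans s t u : conv s t -> conv t u -> conv s u
| Conv_cat s s' t t' : conv s s' -> conv t t' -> conv (s ++ t) (s' ++ t').

Definition conv_eq : rel (seq T) := fun s t => `[< conv s t >].

Lemma conv_eq_refl : reflexive conv_eq.
Proof. by move=> s; apply/asboolP; exact: Conv_refl. Qed.
Lemma conv_eq_sym : ssrbool.symmetric conv_eq.
Proof. by move=> s t; apply/asboolP/asboolP; exact: Conv_sym. Qed.
Lemma conv_eq_trans : ssrbool.transitive conv_eq.
Proof.
by move=> t s u /asboolP st /asboolP tu; apply/asboolP; exact: Conv_trans tu.
Qed.

Canonical conv_eq_equiv :=
  EquivRel conv_eq conv_eq_refl conv_eq_sym conv_eq_trans.

Definition pres : Type := {eq_quot conv_eq}.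
HB.instance Definition _ := Choice.on pres.

Definition word (s : seq T) : pres := \pi_({eq_quot conv_eq}) s.
Definition word_repr (z : pres) : seq T := repr (z : {eq_quot conv_eq}).

Lemma word_reprK z : word (word_repr z) = z.
Proof. exact: reprK. Qed.

Lemma wordP s t : word s = word t <-> conv s t.
Proof. by split=> [/eqmodP/asboolP | e]; last by apply/eqmodP/asboolP. Qed.

Lemma wordW (Q : pres -> Prop) : (forall s, Q (word s)) -> forall z, Q z.
Proof. by move=> Qs z; rewrite -(word_reprK z). Qed.

Lemma word_reprP s : conv (word_repr (word s)) s.
Proof. by apply/wordP; rewrite word_reprK. Qed.

Definition word_cat (z t : pres) := word (word_repr z ++ word_repr t).

Lemma word_catE s t : word_cat (word s) (word t) = word (s ++ t).
Proof. by apply/wordP; apply: Conv_cat; exact: word_reprP. Qed.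

Lemma word_catA : associative word_cat.
Proof.
by elim/wordW=> s; elim/wordW=> t; elim/wordW=> u; rewrite !word_catE catA.
Qed.
Lemma word_cat0 : left_id (word [::]) word_cat.
Proof. by elim/wordW=> s; rewrite word_catE. Qed.
Lemma word_cat0r : right_id (word [::]) word_cat.
Proof. by elim/wordW=> s; rewrite word_catE cats0. Qed.

End PresentedMonoid.

Lemma conv_map (T T' : choiceType) (E : seq T -> seq T -> Prop)
    (E' : seq T' -> seq T' -> Prop) (g : T -> T') :
  (forall s t, E s t -> conv E' (map g s) (map g t)) ->
  forall s t, conv E s t -> conv E' (map g s) (map g t).
Proof.
move=> gE s t; elim=> [? ? /gE // | ? | ? ? _ | ? ? ? _ + _ | ? ? ? ? _ + _].
- exact: Conv_refl.
- exact: Conv_sym.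
- exact: Conv_trans.
- by rewrite !map_cat; exact: Conv_cat.
Qed.

(* Formal sums: [:: u_1; ...; u_k] stands for u_1 + ... + u_k. The relations
   are stable under the product, which is extended to sums by bilinearity. *)
Record sum_presentation := SumPresentation {
  sgen : choiceType;
  sone : sgen;
  smul : sgen -> sgen -> sgen;
  sopp : sgen -> sgen;
  srel : seq sgen -> seq sgen -> Prop;
  smulA : associative smul;
  smul1 : left_id sone smul;
  smulr1 : right_id sone smul;
  srel_swap : forall u v, srel [:: u; v] [:: v; u];
  srel_opp : forall u, conv srel [:: sopp u; u] [::];
  srel_mull : forall u s t, srel s t -> srel (map (smul u) s) (map (smul u) t);
  srel_mulr : forall u s t,
    srel s t -> srel (map (smul^~ u) s) (map (smul^~ u) t)
}.

Section FormalSums.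
Variable F : sum_presentation.
Local Notation T := (sgen F).
Local Notation sconv := (conv (@srel F)).

Lemma conv_swap (s t : seq T) : sconv (s ++ t) (t ++ s).
Proof.
have swap1 u (w : seq T) : sconv (u :: w) (w ++ [:: u]).
  elim: w => [|v w IHw]; first exact: Conv_refl.
  apply: (@Conv_trans _ _ _ [:: v, u & w]).
    apply: (@Conv_cat _ _ [:: u; v] [:: v; u]); last exact: Conv_refl.
    exact/Conv_rel/srel_swap.
  by apply: (@Conv_cat _ _ [:: v] [:: v]) => //; exact: Conv_refl.
elim: s t => [|u s IHs] t; first by rewrite cats0; exact: Conv_refl.
apply: Conv_trans (swap1 u (s ++ t)) _.
by have := IHs (t ++ [:: u]); rewrite -!catA.
Qed.

Lemma perm_conv (s t : seq T) : perm_eq s t -> sconv s t.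
Proof.
elim: s t => [|u s IHs] t st.
  by move: st; rewrite perm_sym => /perm_nilP->; exact: Conv_refl.
have : u \in t by rewrite -(perm_mem st) mem_head.
move=> /splitPr et; case: et st => t1 t2.
rewrite -(cat1s u t2) perm_sym perm_catCA /= perm_cons perm_sym => /IHs st.
apply: (@Conv_trans _ _ _ (([:: u] ++ t1) ++ t2)).
  by rewrite -catA; apply: (@Conv_cat _ _ [:: u] [:: u]) st; exact: Conv_refl.
rewrite -[u :: t2]cat1s catA; apply: Conv_cat; last exact: Conv_refl.
exact: conv_swap.
Qed.

Definition fsum : Type := pres (@srel F).
HB.instance Definition _ := Choice.on fsum.

Definition cls (s : seq T) : fsum := word (@srel F) s.

Lemma clsP s t : cls s = cls t <-> sconv s t.
Proof. exact: wordP. Qed.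

Lemma clsW (Q : fsum -> Prop) : (forall s, Q (cls s)) -> forall z, Q z.
Proof. exact: wordW. Qed.

Definition fsum_opp (z : fsum) : fsum := cls (map (@sopp F) (word_repr z)).
Definition all_mul (s t : seq T) : seq T := [seq smul u v | u <- s, v <- t].
Definition fsum_mul (z t : fsum) : fsum :=
  cls (all_mul (word_repr z) (word_repr t)).

Lemma all_mul_consr s v t :
  sconv (all_mul s (v :: t)) (map (fun u => smul u v) s ++ all_mul s t).
Proof.
by apply: perm_conv; apply/permPl; exact: (perm_allpairs_consr (@smul F) s (fun=> v) (fun=> t)).
Qed.

Lemma all_mul_conv s s' t t' :
  sconv s s' -> sconv t t' -> sconv (all_mul s t) (all_mul s' t').
Proof.
move=> ss' tt'; apply: (@Conv_trans _ _ _ (all_mul s t')).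
  elim: s {ss'} => [|u s IHs]; first exact: Conv_refl.
  rewrite /all_mul !allpairs_cons; apply: Conv_cat IHs.
  apply: conv_map tt' => ? ? /srel_mull h; exact/Conv_rel/h.
elim: ss' => {s s' t tt'} [s s' ss' | s | s s' _ | s s' s'' _ + _ |
    s s' t u _ ss' _ tu].
- elim: t' => [|v t IHt].
    by rewrite /all_mul !allpairs0r; exact: Conv_refl.
  apply: Conv_trans (all_mul_consr _ _ _) _.
  apply: Conv_trans (Conv_sym (all_mul_consr _ _ _)).
  by apply: Conv_cat IHt; exact/Conv_rel/srel_mulr.
- exact: Conv_refl.
- exact: Conv_sym.
- exact: Conv_trans.
- by rewrite /all_mul !allpairs_cat; exact: Conv_cat.
Qed.

Lemma fsum_mulE s t : fsum_mul (cls s) (cls t) = cls (all_mul s t).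
Proof. by apply/clsP; apply: all_mul_conv; exact: word_reprP. Qed.

Lemma fsum_addE s t : word_cat (cls s) (cls t) = cls (s ++ t).
Proof. exact: word_catE. Qed.

Fact fsum_addC : commutative (@word_cat _ (@srel F)).
Proof.
elim/clsW=> s; elim/clsW=> t; rewrite !word_catE.
exact/wordP/conv_swap.
Qed.

Fact fsum_addN : left_inverse (cls [::]) fsum_opp (@word_cat _ (@srel F)).
Proof.
move=> z; rewrite -{2}(word_reprK z) word_catE; apply/clsP.
elim: (word_repr z) => [|u s IHs]; first exact: Conv_refl.
apply: (@Conv_trans _ _ _ ([:: sopp u; u] ++ (map (@sopp F) s ++ s))).
  by apply: perm_conv; rewrite /= perm_cons -cat1s perm_catCA perm_refl.
by apply: (@Conv_cat _ _ _ [::] _ [::]) => //; exact: srel_opp.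
Qed.

Fact fsum_mulA : associative fsum_mul.
Proof.
elim/clsW=> s; elim/clsW=> t; elim/clsW=> u; rewrite !fsum_mulE; congr cls.
elim: s => [|x s IHs] //; rewrite /all_mul !allpairs_cons allpairs_cat.
rewrite -/(all_mul t u) -/(all_mul s t) -!/(all_mul _ _) -IHs; congr (_ ++ _).
rewrite /all_mul map_allpairs allpairs_mapl.
by congr flatten; apply: eq_map => v; apply: eq_map => w; exact: smulA.
Qed.

Fact fsum_mul1 : left_id (cls [:: sone F]) fsum_mul.
Proof.
elim/clsW=> s; rewrite fsum_mulE /all_mul allpairs_cons cats0.
by rewrite (eq_map (@smul1 F)) map_id.
Qed.

Fact fsum_mulr1 : right_id (cls [:: sone F]) fsum_mul.
Proof.
elim/clsW=> s; rewrite fsum_mulE /all_mul allpairs1r.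
by rewrite (eq_map (@smulr1 F)) map_id.
Qed.

Fact fsum_mulDl : left_distributive fsum_mul (@word_cat _ (@srel F)).
Proof.
elim/clsW=> s; elim/clsW=> t; elim/clsW=> u.
by rewrite fsum_addE !fsum_mulE fsum_addE /all_mul allpairs_cat.
Qed.

Fact fsum_mulDr : right_distributive fsum_mul (@word_cat _ (@srel F)).
Proof.
elim/clsW=> s; elim/clsW=> t; elim/clsW=> u.
rewrite fsum_addE !fsum_mulE fsum_addE; apply/clsP/perm_conv.
by apply/permPl; exact: (perm_allpairs_catr (@smul F) s (fun=> t) (fun=> u)).
Qed.

HB.instance Definition _ := GRing.isPzRing.Build fsum
  (@word_catA _ (@srel F)) fsum_addC (@word_cat0 _ (@srel F)) fsum_addN
  fsum_mulA fsum_mul1 fsum_mulr1 fsum_mulDl fsum_mulDr.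

Lemma cls_cat s t : cls (s ++ t) = cls s + cls t.
Proof. exact/esym/fsum_addE. Qed.

Lemma cls_mul s t : cls s * cls t = cls (all_mul s t).
Proof. exact: fsum_mulE. Qed.

End FormalSums.

Section GroupAlgebra.
Variables (R : comPzRingType) (G : groupType).
Local Open Scope group_scope.

Local Notation T := (R * G)%type.

(* The pair (r, g) stands for r g. *)
Inductive group_rel : seq T -> seq T -> Prop :=
| Group_swap u v : group_rel [:: u; v] [:: v; u]
| Group_add r s g : group_rel [:: ((r + s)%R, g)] [:: (r, g); (s, g)]
| Group_0 g : group_rel [:: (0%R, g)] [::].

Definition group_mul (u v : T) : T := ((u.1 * v.1)%R, u.2 * v.2).
Definition group_opp (u : T) : T := ((- u.1)%R, u.2).

Fact group_mulA : associative group_mul.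
Proof. by move=> u v w; rewrite /group_mul /= mulrA mulgA. Qed.
Fact group_mul1 : left_id (1%R, 1) group_mul.
Proof. by case=> r g; rewrite /group_mul /= mul1r mul1g. Qed.
Fact group_mulr1 : right_id (1%R, 1) group_mul.
Proof. by case=> r g; rewrite /group_mul /= mulr1 mulg1. Qed.
Fact group_rel_opp u : conv group_rel [:: group_opp u; u] [::].
Proof.
case: u => r g; apply: (@Conv_trans _ _ _ [:: (0%R, g)]).
  by rewrite -(addNr r); exact/Conv_sym/Conv_rel/Group_add.
exact/Conv_rel/Group_0.
Qed.
Fact group_rel_mull u s t :
  group_rel s t -> group_rel (map (group_mul u) s) (map (group_mul u) t).
Proof.
case=> [v w | r r' g | g] /=; rewrite /group_mul /=.
- exact: Group_swap.
- by rewrite mulrDr; exact: Group_add.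
- by rewrite mulr0; exact: Group_0.
Qed.
Fact group_rel_mulr u s t :
  group_rel s t -> group_rel (map (group_mul^~ u) s) (map (group_mul^~ u) t).
Proof.
case=> [v w | r r' g | g] /=; rewrite /group_mul /=.
- exact: Group_swap.
- by rewrite mulrDl; exact: Group_add.
- by rewrite mul0r; exact: Group_0.
Qed.

Definition group_presentation : sum_presentation :=
  SumPresentation group_mulA group_mul1 group_mulr1 Group_swap
    group_rel_opp group_rel_mull group_rel_mulr.

Definition group_algebra : Type := fsum group_presentation.
HB.instance Definition _ := GRing.PzRing.on group_algebra.

Definition mono (r : R) (g : G) : group_algebra :=
  cls (F := group_presentation) [:: (r, g)].

Definition group_scal (r : R) : group_algebra := mono r 1.

Fact group_scal_zmod_morphism : zmod_morphism group_scal.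
Proof.
suff scalD r s : group_scal (r + s)%R = (group_scal r + group_scal s)%R.
  move=> r s; apply: (addIr (group_scal s)).
  by rewrite -scalD !subrK.
by rewrite -[RHS]cls_cat; apply/clsP/Conv_rel/Group_add.
Qed.
Fact group_scal_monoid_morphism : monoid_morphism group_scal.
Proof.
split=> // r s; rewrite [RHS]cls_mul /all_mul /=.
by rewrite /group_mul /= mulg1.
Qed.
HB.instance Definition _ := GRing.isZmodMorphism.Build R group_algebra
  group_scal group_scal_zmod_morphism.
HB.instance Definition _ := GRing.isMonoidMorphism.Build R group_algebra
  group_scal group_scal_monoid_morphism.

Fact group_scalC r (z : group_algebra) : GRing.comm (group_scal r) z.
Proof.
elim/clsW: z => s; rewrite /GRing.comm !cls_mul; congr cls.
rewrite /all_mul allpairs1l allpairs1r; apply: eq_map => u.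
by rewrite /= /group_mul /= mul1g mulg1 mulrC.
Qed.

HB.instance Definition _ := isPzAlgebra.Build R group_algebra group_scalC.

End GroupAlgebra.

(* The tensor product A (x)_R B along phi : R -> B, as a B-algebra; the pair
   (u, b) stands for the pure tensor of u and b. *)
Section BaseChange.
Variables (R B : comPzRingType) (phi : {rmorphism R -> B}).

Section Algebra.
Variable A : pzAlgType R.

Local Notation T := (A * B)%type.

Inductive tensor_rel : seq T -> seq T -> Prop :=
| Tensor_swap u v : tensor_rel [:: u; v] [:: v; u]
| Tensor_addl u v b : tensor_rel [:: (u + v, b)] [:: (u, b); (v, b)]
| Tensor_addr u b c : tensor_rel [:: (u, b + c)] [:: (u, b); (u, c)]
| Tensor_scal r u b : tensor_rel [:: (scal r * u, b)] [:: (u, phi r * b)]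
| Tensor_0 b : tensor_rel [:: (0, b)] [::].

Definition tensor_mul (u v : T) : T := (u.1 * v.1, u.2 * v.2).
Definition tensor_opp (u : T) : T := (- u.1, u.2).

Fact tensor_mulA : associative tensor_mul.
Proof. by move=> u v w; rewrite /tensor_mul /= !mulrA. Qed.
Fact tensor_mul1 : left_id (1, 1) tensor_mul.
Proof. by case=> u b; rewrite /tensor_mul /= !mul1r. Qed.
Fact tensor_mulr1 : right_id (1, 1) tensor_mul.
Proof. by case=> u b; rewrite /tensor_mul /= !mulr1. Qed.
Fact tensor_rel_opp u : conv tensor_rel [:: tensor_opp u; u] [::].
Proof.
case: u => u b; apply: (@Conv_trans _ _ _ [:: (0, b)]).
  by rewrite -(addNr u); exact/Conv_sym/Conv_rel/Tensor_addl.
exact/Conv_rel/Tensor_0.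
Qed.
Fact tensor_rel_mull u s t :
  tensor_rel s t -> tensor_rel (map (tensor_mul u) s) (map (tensor_mul u) t).
Proof.
case=> [v w | v w b | v b c | r v b | b] /=; rewrite /tensor_mul /=.
- exact: Tensor_swap.
- by rewrite mulrDr; exact: Tensor_addl.
- by rewrite mulrDr; exact: Tensor_addr.
- have -> : u.1 * (scal r * v) = scal r * (u.1 * v).
    by rewrite !mulrA; congr (_ * _); apply/esym; exact: scalC.
  by rewrite mulrCA; exact: Tensor_scal.
- by rewrite mulr0; exact: Tensor_0.
Qed.
Fact tensor_rel_mulr u s t : tensor_rel s t ->
  tensor_rel (map (tensor_mul^~ u) s) (map (tensor_mul^~ u) t).
Proof.
case=> [v w | v w b | v b c | r v b | b] /=; rewrite /tensor_mul /=.
- exact: Tensor_swap.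
- by rewrite mulrDl; exact: Tensor_addl.
- by rewrite mulrDl; exact: Tensor_addr.
- by rewrite -!mulrA; exact: Tensor_scal.
- by rewrite mul0r; exact: Tensor_0.
Qed.

Definition tensor_presentation : sum_presentation :=
  SumPresentation tensor_mulA tensor_mul1 tensor_mulr1 Tensor_swap
    tensor_rel_opp tensor_rel_mull tensor_rel_mulr.

Definition base_change : Type := fsum tensor_presentation.
HB.instance Definition _ := GRing.PzRing.on base_change.

Definition tensors (s : seq T) : base_change :=
  cls (F := tensor_presentation) s.
Definition tensor (u : A) (b : B) : base_change := tensors [:: (u, b)].

Definition base_change_scal (b : B) : base_change := tensor 1 b.

Fact base_change_scal_zmod_morphism : zmod_morphism base_change_scal.
Proof.
suff scalD b c :
    base_change_scal (b + c) = base_change_scal b + base_change_scal c.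
  by move=> b c; apply: (addIr (base_change_scal c)); rewrite -scalD !subrK.
by rewrite -[RHS]cls_cat; apply/clsP/Conv_rel/Tensor_addr.
Qed.
Fact base_change_scal_monoid_morphism : monoid_morphism base_change_scal.
Proof.
split=> // b c; rewrite [RHS]cls_mul /all_mul /=.
by rewrite /tensor_mul /= mulr1.
Qed.
HB.instance Definition _ := GRing.isZmodMorphism.Build B base_change
  base_change_scal base_change_scal_zmod_morphism.
HB.instance Definition _ := GRing.isMonoidMorphism.Build B base_change
  base_change_scal base_change_scal_monoid_morphism.

Fact base_change_scalC b (z : base_change) :
  GRing.comm (base_change_scal b) z.
Proof.
elim/clsW: z => s; rewrite /GRing.comm !cls_mul; congr cls.
rewrite /all_mul allpairs1l allpairs1r; apply: eq_map => u.
by rewrite /= /tensor_mul /= mul1r mulr1 mulrC.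
Qed.

HB.instance Definition _ := isPzAlgebra.Build B base_change base_change_scalC.

End Algebra.

Section Functoriality.
Variables (A A' : pzAlgType R) (f : {pzalg A -> A'}).

Definition tensor_map (u : A * B) : A' * B := (f u.1, u.2).

(* The morphism f (x) id. *)
Definition base_change_map (z : base_change A) : base_change A' :=
  tensors (map tensor_map (word_repr z)).

Lemma base_change_mapE s :
  base_change_map (tensors s) = tensors (map tensor_map s).
Proof.
apply/clsP; apply: (conv_map (E := @tensor_rel A)); last exact: word_reprP.
move=> {}s t [v w | v w b | v b c | r v b | b] /=; rewrite /tensor_map /=;
  apply/Conv_rel.
- exact: Tensor_swap.
- by rewrite rmorphD; exact: Tensor_addl.
- exact: Tensor_addr.
- by rewrite rmorphM /= alg_morphism_scal; exact: Tensor_scal.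
- by rewrite rmorph0; exact: Tensor_0.
Qed.

Fact base_change_map_zmod_morphism : zmod_morphism base_change_map.
Proof.
suff mapD z t :
    base_change_map (z + t) = base_change_map z + base_change_map t.
  by move=> z t; apply: (addIr (base_change_map t)); rewrite -mapD !subrK.
elim/clsW: z => s; elim/clsW: t => t.
by rewrite -cls_cat !base_change_mapE map_cat [LHS]cls_cat.
Qed.
Fact base_change_map_monoid_morphism : monoid_morphism base_change_map.
Proof.
split; first by rewrite base_change_mapE /= /tensor_map /= rmorph1.
elim/clsW=> s; elim/clsW=> t.
rewrite cls_mul !base_change_mapE [RHS]cls_mul; congr cls.
rewrite /all_mul map_allpairs allpairs_mapl allpairs_mapr.
congr flatten; apply: eq_map => u; apply: eq_map => v.
by rewrite /tensor_map /= rmorphM.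
Qed.
HB.instance Definition _ := GRing.isZmodMorphism.Build
  (base_change A) (base_change A') base_change_map
  base_change_map_zmod_morphism.
HB.instance Definition _ := GRing.isMonoidMorphism.Build
  (base_change A) (base_change A') base_change_map
  base_change_map_monoid_morphism.

Fact base_change_map_scal b : base_change_map (scal b) = scal b.
Proof.
by rewrite [LHS]base_change_mapE /= /tensor_map /= rmorph1.
Qed.
HB.instance Definition _ := isAlgMorphism.Build B
  (base_change A) (base_change A') base_change_map base_change_map_scal.

End Functoriality.
End BaseChange.

Arguments base_change_map {R B} phi {A A'} f z.

(* The letter (i, false) is the Artin generator s_(i+1), and (i, true) its
   inverse. *)
Section BraidGroup.
Variable n : nat.
Local Notation T := ('I_n.-1 * bool)%type.
Local Notation pos i := (i, false).

Inductive braid_rel : seq T -> seq T -> Prop :=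
| Braid_cancel i e : braid_rel [:: (i, e); (i, ~~ e)] [::]
| Braid_far (i j : 'I_n.-1) :
    (i.+1 < j)%N -> braid_rel [:: pos i; pos j] [:: pos j; pos i]
| Braid_near (i j : 'I_n.-1) : j = i.+1 :> nat ->
    braid_rel [:: pos i; pos j; pos i] [:: pos j; pos i; pos j].

Definition braid : Type := pres braid_rel.
HB.instance Definition _ := Choice.on braid.

Definition braid_inv (z : braid) : braid :=
  word braid_rel (rev [seq (u.1, ~~ u.2) | u <- word_repr z]).

Lemma rev_cancel s :
  conv braid_rel (rev [seq (u.1, ~~ u.2) | u <- s] ++ s) [::].
Proof.
elim: s => [|[i e] s IHs]; first exact: Conv_refl.
rewrite /= rev_cons cat_rcons; apply: Conv_trans IHs.
apply: Conv_cat; first exact: Conv_refl.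
apply: (@Conv_cat _ _ [:: (i, ~~ e); (i, e)] [::]); last exact: Conv_refl.
by rewrite -{2}[e]negbK; exact/Conv_rel/Braid_cancel.
Qed.

Fact braid_mulVg :
  left_inverse (word braid_rel [::]) braid_inv (@word_cat _ braid_rel).
Proof.
by move=> z; rewrite -{2}(word_reprK z) word_catE; apply/wordP/rev_cancel.
Qed.

Fact braid_mulgV :
  right_inverse (word braid_rel [::]) braid_inv (@word_cat _ braid_rel).
Proof.
move=> z; rewrite -{1}(word_reprK z) word_catE; apply/wordP.
have := rev_cancel (rev [seq (u.1, ~~ u.2) | u <- word_repr z]).
rewrite map_rev revK -map_comp.
by rewrite (eq_map (g := id)) ?map_id // => -[i e] /=; rewrite negbK.
Qed.

HB.instance Definition _ := isGroup.Build braid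
  (@word_catA _ braid_rel) (@word_cat0 _ braid_rel) (@word_cat0r _ braid_rel)
  braid_mulVg braid_mulgV.

Definition artin (i : 'I_n.-1) : braid := word braid_rel [:: pos i].

End BraidGroup.

From mathcomp Require Import mpoly.

Definition ringR : comPzRingType :=
  loc ('X_(0 : 'I_3) * 'X_(1 : 'I_3) * 'X_(2 : 'I_3) : {mpoly rat[3]}).

Definition par_a : ringR := to_loc _ 'X_0.
Definition par_b : ringR := to_loc _ 'X_1.
Definition par_c : ringR := to_loc _ 'X_2.
Definition par_x : ringR := par_b + par_c.
Definition par_y : ringR := par_b * par_c.

Definition ringS : comPzRingType := loc par_x.
Definition R_to_S : {rmorphism ringR -> ringS} := to_loc par_x.

Definition ringRbar : comPzRingType :=
  quot (fun z : ringR => z = par_a ^+ 2 - par_y ^+ 2).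
Definition R_to_Rbar : {rmorphism ringR -> ringRbar} := to_quot _.

Definition ringSbar : comPzRingType :=
  quot (fun z : ringS => z = R_to_S par_a ^+ 2 - R_to_S par_y ^+ 2).
Definition R_to_Sbar : {rmorphism ringR -> ringSbar} := to_quot _ \o R_to_S.

(* In everything indexed by eps, the sign (-1) ^+ eps is the upper one for
   eps = false and the lower one for eps = true. *)
Definition ringSpm (eps : bool) : comPzRingType :=
  quot (fun z : ringS => z = R_to_S par_a - (-1) ^+ eps * R_to_S par_y).
Definition S_to_Spm (eps : bool) : {rmorphism ringS -> ringSpm eps} :=
  to_quot _.
Definition R_to_Spm (eps : bool) : {rmorphism ringR -> ringSpm eps} :=
  S_to_Spm eps \o R_to_S.

Fact Rbar_to_Sbar_subproof u :
  u = par_a ^+ 2 - par_y ^+ 2 -> R_to_Sbar u = 0.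
Proof.
move=> ->; rewrite rmorphB !rmorphXn -!rmorphXn -rmorphB /=.
rewrite -(rmorph0 (to_quot _)); apply/to_quotP; rewrite subr0.
by apply: Ideal_gen; rewrite rmorphB !rmorphXn.
Qed.

Definition Rbar_to_Sbar : {rmorphism ringRbar -> ringSbar} :=
  quot_lift Rbar_to_Sbar_subproof.

Fact Rbar_to_Spm_subproof eps u :
  u = par_a ^+ 2 - par_y ^+ 2 -> R_to_Spm eps u = 0.
Proof.
move=> ->; rewrite /R_to_Spm /=.
rewrite -(rmorph0 (S_to_Spm eps)); apply/to_quotP; rewrite subr0.
have sqrB (v w : ringS) :
    v ^+ 2 - w ^+ 2 = (v - (-1) ^+ eps * w) * (v + (-1) ^+ eps * w).
  by rewrite -subr_sqr exprMn sqrr_sign mul1r.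
rewrite rmorphB !rmorphXn sqrB.
by apply: Ideal_mulr; exact: Ideal_gen.
Qed.

Definition Rbar_to_Spm (eps : bool) : {rmorphism ringRbar -> ringSpm eps} :=
  quot_lift (@Rbar_to_Spm_subproof eps).

Definition ringSbar' : comPzRingType :=
  loc (R_to_Sbar (par_b * par_c - 1)).
Definition Rbar_to_Sbar' : {rmorphism ringRbar -> ringSbar'} :=
  to_loc (R_to_Sbar (par_b * par_c - 1)) \o Rbar_to_Sbar.

Section Algebras.
Variable n : nat.
Local Notation index := 'I_n.-1.

Definition braid_algebra : pzAlgType ringR := group_algebra ringR (braid n).

Definition braid_s (i : index) : braid_algebra := mono 1 (artin i).
Definition braid_sV (i : index) : braid_algebra := mono 1 (artin i)^-1%g.

Definition hecke3 : pzAlgType ringR :=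
  quot (fun z : braid_algebra => exists i,
    z = (braid_s i - scal par_a) * (braid_s i - scal par_b) *
        (braid_s i - scal par_c)).

Definition hecke_s (i : index) : hecke3 := to_quot _ (braid_s i).
Definition hecke_sV (i : index) : hecke3 := to_quot _ (braid_sV i).

(* The element R_i, for j = i + 1. *)
Definition rel_R (i j : index) : hecke3 :=
  let s := hecke_s in let sV := hecke_sV in
  - scal par_y * s i * sV j * s i
  + scal (par_y ^+ 2) * sV j * s i * sV j
  - s i * s j * s i
  - scal (par_x * par_y ^+ 2) * sV j ^+ 2
  + scal par_x * s i ^+ 2
  + scal (par_y ^+ 3) * sV j * sV i * sV j.

Definition BMW_tilde : pzAlgType ringR :=
  quot (fun z : hecke3 => exists i j : index,
    j = i.+1 :> nat /\ z = rel_R i j).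

Definition BMW_bar : pzAlgType ringRbar := base_change R_to_Rbar BMW_tilde.

Definition BMW_bar_s (i : index) : BMW_bar :=
  tensor R_to_Rbar (to_quot _ (hecke_s i)) 1.

Section Sign.
Variable eps : bool.

Definition hecke3_pm : pzAlgType (ringSpm eps) :=
  base_change (R_to_Spm eps) hecke3.

Definition hecke_pm_s (i : index) : hecke3_pm :=
  tensor (R_to_Spm eps) (hecke_s i) 1.
Definition hecke_pm_sV (i : index) : hecke3_pm :=
  tensor (R_to_Spm eps) (hecke_sV i) 1.

Definition pm_a : ringSpm eps := R_to_Spm eps par_a.
Definition pm_xV : ringSpm eps := S_to_Spm eps (loc_inv par_x).

Definition hecke_pm_e (i : index) : hecke3_pm :=
  scal pm_xV * (scal pm_a * hecke_pm_sV i + (-1) ^+ eps * hecke_pm_s i)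
  - (-1) ^+ eps.

(* The indices i and j are those of s_1 and s_2. *)
Definition BMW_pm : pzAlgType (ringSpm eps) :=
  quot (fun z : hecke3_pm => exists i j : index,
    [/\ i = 0 :> nat, j = 1 :> nat &
      let e := hecke_pm_e i in
      z = e * hecke_pm_s j * e - e \/ z = e * hecke_pm_sV j * e - e]).

Definition BMW_pm_s (i : index) : BMW_pm := to_quot _ (hecke_pm_s i).

(* BMW_pm as an algebra over R/(a^2 - y^2). *)
Definition BMW_pm_bar : pzAlgType ringRbar :=
  restrict_scalars (Rbar_to_Spm eps) BMW_pm.

End Sign.

Definition BMW_sum : pzAlgType ringRbar :=
  (BMW_pm_bar false * BMW_pm_bar true)%type.

End Algebras.

(* Main.v *)
From HB Require Import structures.
Require Import Defs.
From mathcomp Require Import all_boot all_algebra.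
From mathcomp Require Import boolp ring mpoly.

(* Let a = eps y with eps = 1 or -1, and put E_i = eps e_i, that is
   E_i = (s_i^2 - x s_i + y) / (x s_i), so that y s_i^-1 = x (E_i + 1) - s_i.
   Write s, t, E, F for s_i, s_(i+1), E_i, E_(i+1), and u = y t^-1. Then
   R_i = x (u E u - s F s), which vanishes if and only if y u E = s^2 t E.
   If E t E = E t^-1 E = eps E, then F = s t E t^-1 s^-1 gives y F E = s t E,
   from which y u E = s^2 t E follows by expanding s^2.
   Conversely, put X = E t E and assume that R_i = 0. Expanding y u E = s^2 t E
   gives a X = y E + y F E - s t E; multiplying by E on the left shows that
   X = E t^-1 E. Next, s t E = (y s^-1) (y t^-1) E gives
   s F E = y X + x F E + (x - a) E - t E, and multiplying this by t, where
   t s F E = E t s E = a X, yields (y - 1) (X - eps E) = 0.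
   So BMW_bar and BMW^eps agree modulo a - eps y once x and y - 1 are
   invertible; and as (a - y) (a + y) = 0 with 2 y a unit, the two quotients
   modulo a - y and a + y determine the whole algebra. *)

Set Implicit Arguments.
Unset Strict Implicit.
Unset Printing Implicit Defensive.

Import GRing.Theory.
Local Open Scope ring_scope.

(** * Identities of noncommutative polynomials *)

Inductive ncexpr (K : Type) : Type :=
| NCvar of nat
| NCzero
| NCone
| NCcoef of K
| NCadd of ncexpr K & ncexpr K
| NCopp of ncexpr K
| NCmul of ncexpr K & ncexpr K.
Arguments NCvar {K}.
Arguments NCzero {K}.
Arguments NCone {K}.

Section Noncommutative.
Variables (K : comPzRingType) (A : pzRingType) (phi : {rmorphism K -> A}).
Hypothesis phiC : forall k u, GRing.comm (phi k) u.

Fixpoint nceval (env : nat -> A) (e : ncexpr K) : A :=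
  match e with
  | NCvar i => env i
  | NCzero => 0
  | NCone => 1
  | NCcoef k => phi k
  | NCadd e1 e2 => nceval env e1 + nceval env e2
  | NCopp e1 => - nceval env e1
  | NCmul e1 e2 => nceval env e1 * nceval env e2
  end.

(** Letters are closed numerals, so [lazy] decides this test and merges equal words while the
    coefficients stay symbolic. *)
Fixpoint word_eqb (v w : seq nat) : bool :=
  match v, w with
  | [::], [::] => true
  | i :: v', j :: w' => if Nat.eqb i j then word_eqb v' w' else false
  | _, _ => false
  end.

Fixpoint nc_insert (k : K) (w : seq nat) (p : seq (K * seq nat)) :=
  match p with
  | [::] => [:: (k, w)]
  | m :: p' =>
      if word_eqb w m.2 then (k + m.1, w) :: p' else m :: nc_insert k w p'
  end.

Fixpoint nc_add (p q : seq (K * seq nat)) :=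
  match p with
  | [::] => q
  | m :: p' => nc_insert m.1 m.2 (nc_add p' q)
  end.

Fixpoint nc_mul1 (k : K) (w : seq nat) (q : seq (K * seq nat)) :=
  match q with
  | [::] => [::]
  | m :: q' => (k * m.1, w ++ m.2) :: nc_mul1 k w q'
  end.

Fixpoint nc_mul (p q : seq (K * seq nat)) :=
  match p with
  | [::] => [::]
  | m :: p' => nc_add (nc_mul1 m.1 m.2 q) (nc_mul p' q)
  end.

Fixpoint nc_norm (e : ncexpr K) : seq (K * seq nat) :=
  match e with
  | NCvar i => [:: (1, [:: i])]
  | NCzero => [::]
  | NCone => [:: (1, [::])]
  | NCcoef k => [:: (k, [::])]
  | NCadd e1 e2 => nc_add (nc_norm e1) (nc_norm e2)
  | NCopp e1 => nc_mul1 (-1) [::] (nc_norm e1)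
  | NCmul e1 e2 => nc_mul (nc_norm e1) (nc_norm e2)
  end.

(** A conjunction in [Prop], which leaves to [ring] one commutative identity for each word. *)
Fixpoint nc_null (p : seq (K * seq nat)) : Prop :=
  match p with
  | [::] => True
  | m :: p' => m.1 = 0 /\ nc_null p'
  end.

Variable env : nat -> A.

Let mon (k : K) (w : seq nat) := phi k * \prod_(i <- w) env i.
Let sum p := \sum_(m <- p) mon m.1 m.2.

Let word_eqbP v w : word_eqb v w -> v = w.
Proof.
elim: v w => [|i v IHv] [|j w] //=.
by case: (PeanoNat.Nat.eqb_spec i j) => // -> /IHv ->.
Qed.

Let sum_insert k w p : sum (nc_insert k w p) = mon k w + sum p.
Proof.
rewrite /sum; elim: p => [|m p IHp] /=; first by rewrite !big_cons.
case: ifP => [/word_eqbP -> | _]; rewrite !big_cons /=.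
  by rewrite addrA /mon rmorphD mulrDl.
by rewrite IHp addrCA.
Qed.

Let sum_add p q : sum (nc_add p q) = sum p + sum q.
Proof.
elim: p => [|m p IHp] /=; first by rewrite /sum big_nil add0r.
by rewrite sum_insert IHp /sum big_cons addrA.
Qed.

(** Centrality moves the second coefficient past the first word. *)
Let monM k v l w : mon (k * l) (v ++ w) = mon k v * mon l w.
Proof.
rewrite /mon rmorphM big_cat /= -!mulrA; congr (_ * _).
by rewrite !mulrA; congr (_ * _); apply: phiC.
Qed.

Let sum_mul1 k w q : sum (nc_mul1 k w q) = mon k w * sum q.
Proof.
rewrite /sum; elim: q => [|m q IHq] /=; first by rewrite !big_nil mulr0.
by rewrite !big_cons IHq /= monM mulrDr.
Qed.

Let sum_mul p q : sum (nc_mul p q) = sum p * sum q.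
Proof.
elim: p => [|m p IHp] /=; first by rewrite /sum big_nil mul0r.
by rewrite sum_add sum_mul1 IHp [sum (m :: p)]big_cons mulrDl.
Qed.

Let sum_norm e : sum (nc_norm e) = nceval env e.
Proof.
elim: e => [i|||k|e1 IH1 e2 IH2|e1 IH1|e1 IH1 e2 IH2] /=.
- by rewrite /sum big_seq1 /mon /= big_seq1 rmorph1 mul1r.
- by rewrite /sum big_nil.
- by rewrite /sum big_seq1 /mon /= big_nil rmorph1 mulr1.
- by rewrite /sum big_seq1 /mon /= big_nil mulr1.
- by rewrite sum_add IH1 IH2.
- by rewrite sum_mul1 IH1 /mon big_nil rmorphN1 mulr1 mulN1r.
- by rewrite sum_mul IH1 IH2.
Qed.

Lemma nc_correct e1 e2 : nc_null (nc_norm (NCadd e1 (NCopp e2))) ->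
  nceval env e1 = nceval env e2.
Proof.
move=> p0; apply: subr0_eq.
rewrite -[LHS]/(nceval env (NCadd e1 (NCopp e2))) -sum_norm.
elim: (nc_norm _) p0 => [|m p IHp] /=; first by rewrite /sum big_nil.
by case=> m0 /IHp; rewrite /sum big_cons /mon m0 rmorph0 mul0r add0r.
Qed.

End Noncommutative.

(** * Reification of ring terms, and linear combinations of relations *)

Ltac nc_mem x l :=
  lazymatch l with
  | nil => false
  | x :: _ => true
  | _ :: ?l' => nc_mem x l'
  end.

Ltac nc_index x l :=
  lazymatch l with
  | x :: _ => constr:(O)
  | _ :: ?l' => let i := nc_index x l' in constr:(S i)
  end.

Ltac nc_atoms phi u l :=
  lazymatch u with
  | @GRing.add _ ?v ?w => let l' := nc_atoms phi v l in nc_atoms phi w l'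
  | @GRing.opp _ ?v => nc_atoms phi v l
  | @GRing.mul _ ?v ?w => let l' := nc_atoms phi v l in nc_atoms phi w l'
  | @GRing.zero _ => l
  | @GRing.one _ => l
  | @GRing.RMorphism.sort _ _ phi ?k => l
  | _ => lazymatch nc_mem u l with true => l | false => constr:(u :: l) end
  end.

Ltac nc_reify K phi u l :=
  lazymatch u with
  | @GRing.add _ ?v ?w =>
      let e := nc_reify K phi v l in let f := nc_reify K phi w l in
      constr:(NCadd e f)
  | @GRing.opp _ ?v => let e := nc_reify K phi v l in constr:(NCopp e)
  | @GRing.mul _ ?v ?w =>
      let e := nc_reify K phi v l in let f := nc_reify K phi w l in
      constr:(NCmul e f)
  | @GRing.zero _ => constr:(@NCzero K)
  | @GRing.one _ => constr:(@NCone K)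
  | @GRing.RMorphism.sort _ _ phi ?k => constr:(@NCcoef K k)
  | _ => let i := nc_index u l in constr:(@NCvar K i)
  end.

(* Proves identities of noncommutative polynomials with central coefficients
   in the image of phi; coefficients are compared by ring, modulo e. *)
Ltac nc_ring phi phiC e :=
  lazymatch type of phiC with forall (k : ?K) _, _ =>
  lazymatch goal with |- @eq ?T ?u ?v =>
    let l := nc_atoms phi u (@nil T) in
    let l := nc_atoms phi v l in
    let eu := nc_reify K phi u l in
    let ev := nc_reify K phi v l in
    let env := constr:(fun i => @nth T 0 l i) in
    refine (@nc_correct _ _ _ phiC env eu ev _);
    lazy [nc_null nc_norm nc_add nc_insert nc_mul nc_mul1 word_eqb Nat.eqb cat
          fst snd];
    repeat split; ring: e
  end end.

(** The proof is an argument so that a combination can cite each relation by its name. *)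
Definition nc_sub (A : pzRingType) (u v : A) (_ : u = v) := u - v.

Lemma nc_subE (A : pzRingType) (u v : A) (h : u = v) : nc_sub h = 0.
Proof. by rewrite /nc_sub h subrr. Qed.

(* Proves an equality by exhibiting the difference of its sides as a
   combination c of differences of known equalities. *)
Ltac nc_linear phi phiC e c :=
  apply: subr0_eq; transitivity c;
  [rewrite /nc_sub; nc_ring phi phiC e
  |by rewrite !nc_subE ?(mulr0, mul0r, oppr0, addr0)].

(** * Algebra in the cubic Hecke algebra on three strands *)

Lemma intertwine_inv (A : pzRingType) (g s sV t tV : A) :
  s * sV = 1 -> tV * t = 1 -> g * s = t * g -> g * sV = tV * g.
Proof.
move=> ssV tVt gs; rewrite -[g * sV]mul1r -tVt -!mulrA [t * _]mulrA -gs.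
by rewrite -!mulrA ssV mulr1.
Qed.

Section CubicBraids.
Variables (K : comPzRingType) (A : pzRingType) (phi : {rmorphism K -> A}).
Hypothesis phiC : forall k u, GRing.comm (phi k) u.
Variables (eps x xV y yV : K).
Hypotheses (epsK : eps * eps = 1) (xVK : xV * x = 1) (yVK : yV * y = 1).
Local Notation a := (eps * y).
Local Notation d := nc_sub.

Ltac linear c := nc_linear phi phiC epsK c.

(** Inverse scalars are kept out of the computations: an identity is proved after multiplication by
    a unit. *)
Lemma phi_cancel k l (u v : A) : k * l = 1 -> phi l * u = phi l * v -> u = v.
Proof.
move=> kl e; rewrite -[u]mul1r -[v]mul1r -(rmorph1 phi) -kl rmorphM.
by rewrite -!mulrA e.
Qed.

Definition cubic_unit (s sV : A) := [/\ sV * s = 1, s * sV = 1 &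
  (s - phi a) * (s * s - phi x * s + phi y) = 0].

(* For a cubic unit, this is (s^2 - x s + y) / (x s), a multiple of the
   projector on the eigenvalue a; e_i is eps times it. *)
Definition cup (s sV : A) := phi xV * (phi y * sV + s) - 1.

(** The element R_i, with [s] and [t] in the place of s_i and s_(i+1). *)
Definition braid_defect (s sV t tV : A) :=
  - phi y * s * tV * s + phi (y ^+ 2) * tV * s * tV - s * t * s
  - phi (x * y ^+ 2) * (tV * tV) + phi x * (s * s)
  + phi (y ^+ 3) * tV * sV * tV.

Lemma cubic_factor k l m (s : A) :
  (s - phi k) * (s - phi l) * (s - phi m) = 0 ->
  (s - phi k) * (s * s - phi (l + m) * s + phi (l * m)) = 0.
(* [ring] expects a side relation on the coefficients; a trivial one is supplied. *)
Proof. by move=> s0; nc_linear phi phiC (erefl (0 : K)) (d s0). Qed.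

(** * Eigenvalue equations of a single cup *)

Section Cup.
Variables (s sV : A).
Hypothesis sP : cubic_unit s sV.
Local Notation E := (cup s sV).

(** The definition of [cup] solved for the inverse: the computations below trade s^-1 for the cup
    through it. *)
Lemma cup_inv : phi y * sV = phi x * (E + 1) - s.
Proof.
rewrite /cup subrK mulrA -rmorphM [x * _]mulrC xVK rmorph1 mul1r.
by rewrite addrK.
Qed.

(** x s E is s^2 - x s + y, which the cubic relation makes s - a annihilate. *)
Lemma mul_cup : s * E = phi a * E.
Proof.
case: sP => sVs ssV cub; apply: (phi_cancel xVK).
linear (phi y * d ssV + sV * d cub - (s - phi a) * d cup_inv
  - d sVs * (phi y + s * s - phi x * s - phi a * s + phi (a * x))).
Qed.

(** E is a polynomial in s and s^-1, so it commutes with s. *)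
Lemma cup_mul : E * s = phi a * E.
Proof.
case: sP => sVs ssV _; apply: (phi_cancel xVK).
linear (phi y * d sVs - phi y * d ssV - d cup_inv * s + s * d cup_inv
  + phi x * d mul_cup).
Qed.

(** On the eigenspace of a = eps y, s^-1 acts as eps y^-1, because eps^2 = 1. *)
Lemma inv_cup : phi y * (sV * E) = phi eps * E.
Proof.
case: sP => sVs _ _.
linear (phi eps * d sVs * E - phi eps * sV * d mul_cup).
Qed.

(** Compares two values of y s^-1 E, given by [inv_cup] and by [cup_inv]. *)
Lemma cup_sqr : phi x * (E * E) = phi (eps * (y + 1) - x) * E.
Proof. linear (d inv_cup + d mul_cup - d cup_inv * E). Qed.

End Cup.

Lemma braid_conj (s sV t tV : A) : s * sV = 1 -> tV * t = 1 ->
  s * t * s = t * s * t -> s * t * sV = tV * s * t.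
Proof.
move=> ssV tVt sts.
linear (tV * s * t * d ssV - d tVt * s * t * sV - tV * d sts * sV).
Qed.

(** By the braid relation, conjugation by s t carries s to t, hence s^-1 to t^-1 and one cup to the
    other. *)
Lemma braid_cup (s sV t tV : A) : cubic_unit s sV -> cubic_unit t tV ->
  s * t * s = t * s * t -> s * t * cup s sV = cup t tV * s * t.
Proof.
case=> _ ssV _ [tVt _ _] sts; apply: (phi_cancel xVK).
linear (phi y * d (braid_conj ssV tVt sts) + d sts
  - s * t * d (cup_inv s sV) + d (cup_inv t tV) * s * t).
Qed.

(** * Two neighbouring generators *)

Section CupPair.
Variables (s sV t tV : A).
Hypotheses (sP : cubic_unit s sV) (tP : cubic_unit t tV).
Hypothesis sts : s * t * s = t * s * t.
Local Notation E := (cup s sV).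
Local Notation F := (cup t tV).
Let sVs : sV * s = 1. Proof. by case: sP. Qed.
Let ssV : s * sV = 1. Proof. by case: sP. Qed.
Let tVt : tV * t = 1. Proof. by case: tP. Qed.
Let ttV : t * tV = 1. Proof. by case: tP. Qed.
Let HE := cup_inv s sV.
Let HF := cup_inv t tV.
Let stE := braid_cup sP tP sts.
Let tsF := braid_cup tP sP (esym sts).
Let sE := mul_cup sP.
Let tF := mul_cup tP.

(** Substituting [cup_inv] in y^3 t^-1 s^-1 t^-1 and in y s t^-1 s cancels every term free of
    cups. *)
Lemma braid_defectE : braid_defect s sV t tV =
  phi x * (phi (y ^+ 2) * tV * E * tV - s * F * s).
Proof.
rewrite /braid_defect.
linear (phi (y ^+ 2) * tV * d HE * tV - s * d HF * s). Qed.

(** The relation s^2 = x s + x a E - y, multiplied by t E on the right. *)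
Let ssE : s * s * t * E =
  phi x * (s * t * E) + phi (x * a) * (E * t * E) - phi y * (t * E).
Proof.
linear (s * d HE * t * E - phi y * d ssV * t * E + phi x * d sE * t * E).
Qed.

Lemma cup_defect : E * t * E = phi eps * E -> E * tV * E = phi eps * E ->
  braid_defect s sV t tV = 0.
Proof.
move=> h1 h2.
(* In F E = s t E t^-1 s^-1 E the factor y s^-1 E is eps E, which leaves E t^-1 E for [h2]. *)
have FE : phi y * (F * E) = s * t * E.
  linear (s * t * E * tV * d (inv_cup sP) + phi eps * s * t * d h2
    - phi y * d stE * tV * sV * E - phi y * F * s * d ttV * sV * E
    - phi y * F * d ssV * E).
have uE : phi (y ^+ 2) * (tV * E) = s * s * t * E.
  linear (phi y * d HF * E - d ssE + phi x * d FE - phi (x * a) * d h1).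
rewrite braid_defectE.
linear (phi x * (d uE * tV + s * d stE * tV + s * F * s * d ttV)).
Qed.

Hypothesis defect0 : braid_defect s sV t tV = 0.

(** The vanishing defect reads y^2 t^-1 E t^-1 = s F s; multiply by t on the right and use F s t = s
    t E. *)
Let uE : phi (y ^+ 2) * (tV * E) = s * s * t * E.
Proof.
have uEu : phi (y ^+ 2) * tV * E * tV = s * F * s.
  apply: (phi_cancel xVK); linear (d defect0 - d braid_defectE).
linear (d uEu * t - phi (y ^+ 2) * tV * E * d tVt - s * d stE).
Qed.

(** Two expansions of y^2 t^-1 E, by [cup_inv] for t and by [uE] with [ssE]; the terms y t E cancel
    and x is divided out. *)
Let XE : phi a * (E * t * E) = phi y * E + phi y * (F * E) - s * t * E.
Proof. apply: (phi_cancel xVK); linear (phi y * d HF * E - d ssE - d uE). Qed.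

Let y2VK : yV ^+ 2 * y ^+ 2 = 1.
Proof. by rewrite -exprMn yVK expr1n. Qed.

(** In E times [XE], [cup_sqr] and [cup_mul] collect the terms in E t E into y (y + 1) E t E, after
    multiplication by x. Eliminating E F E by [cup_inv] for t leaves y^2 E t E = y^2 E t^-1 E. *)
Lemma defect_cup_inv : E * t * E = E * tV * E.
Proof.
apply: (phi_cancel y2VK).
linear (phi x * E * d XE - phi a * d (cup_sqr sP) * t * E
  - phi x * d (cup_mul sP) * t * E - phi y * E * d HF * E).
Qed.

Let sFE : s * F * E = phi y * (E * t * E) + phi x * (F * E)
  + phi (x - a) * E - t * E.
Proof.
have e : s * t * E = phi (y ^+ 2) * (sV * tV * E).
  linear (- sV * d uE - d sVs * s * t * E).
(* Once both inverses are expanded, s t E occurs on each side and cancels; the rest is a multiple of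
   the unit x. *)
apply: (phi_cancel xVK).
linear (d e + d HE * phi y * tV * E + (phi x * (E + 1) - s) * d HF * E
  - phi x * E * d HF * E - phi (x * y) * d defect_cup_inv - phi x * d sE).
Qed.

(* Multiplying [sFE] by t, as [t s F E = E t s E] is a (E t E). *)
Lemma defect_cup : phi (y - 1) * (E * t * E - phi eps * E) = 0.
Proof.
apply: (phi_cancel y2VK).
have tsFE : t * s * F * E = phi a * (E * t * E).
  linear (d tsF * E + E * t * d sE).
(* The second group evaluates t E t E through [XE], with t F = a F and t s t E = s t s E = a s t E;
   the last one evaluates t t E by [cup_inv]. *)
linear (phi a * (d tsFE - t * d sFE)
  - phi y * (t * d XE + phi y * d tF * E
     - (s * t * d sE - d sts * E + phi a * d XE))
  - phi (a * x) * d tF * E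
  + phi a * (t * d HF * E - phi y * d ttV * E + phi x * d tF * E)).
Qed.

End CupPair.

(** Conjugation by [g] transports the relation; it is applied with [t] a neighbour of [s] or the
    inverse of one. *)
Lemma cup_conj (g gV s sV t s2 s2V t2 : A) : g * gV = 1 ->
  g * s = s2 * g -> g * sV = s2V * g -> g * t = t2 * g ->
  cup s sV * t * cup s sV = phi eps * cup s sV ->
  cup s2 s2V * t2 * cup s2 s2V = phi eps * cup s2 s2V.
Proof.
move=> ggV gs gsV gt.
have: g * cup s sV = cup s2 s2V * g.
  rewrite /cup; linear (phi (xV * y) * d gsV + phi xV * d gs).
move: (cup s sV) (cup s2 s2V) => E E2 gE EtE.
linear ((g * d EtE - d gE * t * E - E2 * d gt * E - E2 * t2 * d gE
  + phi eps * d gE) * gV - (E2 * t2 * E2 - phi eps * E2) * d ggV).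
Qed.
End CubicBraids.

Lemma braid_defect_morph (K L : comPzRingType) (A C : pzRingType)
    (phi : {rmorphism K -> A}) (psi : {rmorphism L -> C})
    (h : {rmorphism K -> L}) (m : {rmorphism A -> C}) x y s sV t tV :
  (forall k, m (phi k) = psi (h k)) ->
  m (braid_defect phi x y s sV t tV) =
    braid_defect psi (h x) (h y) (m s) (m sV) (m t) (m tV).
Proof.
move=> mphi; rewrite /braid_defect !(rmorphD m, rmorphN m, rmorphM m).
by rewrite !mphi !(rmorphM h) !rmorphXn.
Qed.

(** * Base change and Hecke algebras *)

Section BaseChange.
Variables (R B : comPzRingType) (phi : {rmorphism R -> B}) (A : pzAlgType R).
Local Notation AB := (base_change phi A).

Lemma tensorsE s :
  tensors phi s = \sum_(u <- s) tensor phi u.1 u.2 :> AB.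
Proof.
elim: s => [|[u b] s IHs]; first by rewrite big_nil.
rewrite big_cons -IHs.
exact: (@cls_cat (tensor_presentation phi A) [:: (u, b)] s).
Qed.

Lemma tensorM u v b c :
  tensor phi u b * tensor phi v c = tensor phi (u * v) (b * c) :> AB.
Proof. exact: cls_mul. Qed.

Definition to_base_change (u : A) : AB := tensor phi u 1.

Fact to_base_change_zmod_morphism : zmod_morphism to_base_change.
Proof.
suff toD u v : to_base_change (u + v) = to_base_change u + to_base_change v.
  by move=> u v; apply: (addIr (to_base_change v)); rewrite -toD !subrK.
rewrite -[RHS](@cls_cat (tensor_presentation phi A) [:: _] [:: _]).
exact/clsP/Conv_rel/Tensor_addl.
Qed.
Fact to_base_change_monoid_morphism : monoid_morphism to_base_change.
Proof. by split=> // u v; rewrite [RHS]tensorM mulr1. Qed.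
HB.instance Definition _ := GRing.isZmodMorphism.Build A AB to_base_change
  to_base_change_zmod_morphism.
HB.instance Definition _ := GRing.isMonoidMorphism.Build A AB to_base_change
  to_base_change_monoid_morphism.

Lemma to_base_change_scal r : to_base_change (scal r) = scal (phi r).
Proof.
rewrite -[RHS]/(tensor phi 1 (phi r)) -[in RHS](mulr1 (phi r)).
rewrite /to_base_change -[scal r in LHS]mulr1.
by apply/clsP/Conv_rel/Tensor_scal.
Qed.

Lemma tensorE u b : tensor phi u b = to_base_change u * scal b :> AB.
Proof. by rewrite [RHS]tensorM mulr1 mul1r. Qed.

Lemma base_change_ind (P : AB -> Prop) : P 0 ->
  (forall z t, P z -> P t -> P (z + t)) ->
  (forall u b, P (to_base_change u * scal b)) -> forall z, P z.
Proof.
move=> P0 PD Pt; elim/clsW=> s; rewrite [cls s]tensorsE.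
by elim/big_ind: _ => // u _; rewrite tensorE.
Qed.

Section Lift.
Variables (C : pzRingType) (f : {rmorphism A -> C}) (g : {rmorphism B -> C}).

(** The universal property of the tensor product. The two proofs are arguments so that the morphism
    structures declared below can be inferred from the term. *)
Definition base_change_lift (fgC : forall u b, GRing.comm (f u) (g b))
    (fg : forall r, f (scal r) = g (phi r)) (z : AB) : C :=
  \sum_(u <- word_repr z) f u.1 * g u.2.

Hypothesis fgC : forall u b, GRing.comm (f u) (g b).
Hypothesis fg : forall r, f (scal r) = g (phi r).
Local Notation lift := (base_change_lift fgC fg).

(** Each tensor relation preserves the sum, so the chosen representative is immaterial. *)
Lemma base_change_lift_tensors s :
  lift (tensors phi s) = \sum_(u <- s) f u.1 * g u.2.
Proof.
suff: forall s t, conv (@tensor_rel _ _ phi A) s t ->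
    \sum_(u <- s) f u.1 * g u.2 = \sum_(u <- t) f u.1 * g u.2.
  by apply; exact: word_reprP.
move=> {}s t.
elim=> {s t} [s t | s | s t _ -> | s t w _ -> _ -> | s s' t t' _ e _ e'] //.
- case=> [u v | u v b | u b c | r u b | b]; rewrite !(big_cons, big_nil) /=.
  + by rewrite addrCA.
  + by rewrite rmorphD mulrDl !addr0.
  + by rewrite rmorphD mulrDr !addr0.
  + by rewrite !rmorphM fg -fgC mulrA.
  + by rewrite rmorph0 mul0r addr0.
- by rewrite !big_cat e e'.
Qed.

Let liftD z t : lift (z + t) = lift z + lift t.
Proof.
elim/clsW: z => s; elim/clsW: t => t.
by rewrite -cls_cat !base_change_lift_tensors big_cat.
Qed.

Let lift0 : lift 0 = 0.
Proof. by apply: (addIr (lift 0)); rewrite -liftD !add0r. Qed.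

Fact base_change_lift_zmod_morphism : zmod_morphism lift.
Proof. by move=> z t; apply: (addIr (lift t)); rewrite -liftD !subrK. Qed.

Lemma base_change_liftE u b : lift (tensor phi u b) = f u * g b.
Proof. by rewrite base_change_lift_tensors big_seq1. Qed.

Fact base_change_lift_monoid_morphism : monoid_morphism lift.
Proof.
split; first by rewrite base_change_liftE !rmorph1 mulr1.
move=> z; elim/base_change_ind=> [|t t' et et'|v c].
- by rewrite mulr0 lift0 mulr0.
- by rewrite mulrDr !liftD et et' mulrDr.
elim/base_change_ind: z => [|t t' et et'|u b].
- by rewrite mul0r lift0 mul0r.
- by rewrite mulrDl !liftD et et' mulrDl.
rewrite -!tensorE tensorM !base_change_liftE !rmorphM -!mulrA.
by congr (_ * _); rewrite !mulrA; congr (_ * _); apply: fgC.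
Qed.

HB.instance Definition _ := GRing.isZmodMorphism.Build AB C lift
  base_change_lift_zmod_morphism.
HB.instance Definition _ := GRing.isMonoidMorphism.Build AB C lift
  base_change_lift_monoid_morphism.

Lemma base_change_lift_to u : lift (to_base_change u) = f u.
Proof. by rewrite base_change_liftE rmorph1 mulr1. Qed.

Lemma base_change_lift_scal b : lift (scal b) = g b.
Proof. by rewrite base_change_liftE rmorph1 mul1r. Qed.

End Lift.
End BaseChange.

(** A left factor can be moved to the right of a central k. *)
Lemma central_ideal (A : pzRingType) (k : A) :
  (forall u, GRing.comm k u) ->
  forall u, two_sided_ideal (fun z => z = k) u -> exists v, u = k * v.
Proof.
move=> kC u; elim=> {u} [u -> | | u v _ [u' ->] _ [v' ->] | u v _ [v' ->] |
    u v _ [u' ->]].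
- by exists 1; rewrite mulr1.
- by exists 0; rewrite mulr0.
- by exists (u' + v'); rewrite mulrDr.
- by exists (u * v'); rewrite !mulrA kC.
- by exists (u' * v); rewrite mulrA.
Qed.

(** * Relations among the generators of the cubic Hecke algebra *)

Section Hecke.
Variable n : nat.
Local Notation index := 'I_n.-1.
Implicit Types i j : index.

Lemma mono_artinM (z t : braid n) :
  mono 1 z * mono 1 t = mono 1 (z * t)%g :> braid_algebra n.
Proof. by rewrite [LHS]cls_mul /all_mul /= /group_mul /= mulr1. Qed.

Lemma braid_wordM s t :
  ((word (@braid_rel n) s : braid n) * (word (@braid_rel n) t : braid n))%g =
  word (@braid_rel n) (s ++ t).
Proof. exact: word_catE. Qed.

Definition to_hecke : {rmorphism braid_algebra n -> hecke3 n} := to_quot _.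

Lemma mono11 : mono 1 1%g = 1 :> braid_algebra n.
Proof. by []. Qed.

Lemma hecke_sVK i : hecke_sV i * hecke_s i = 1.
Proof.
have := congr1 to_hecke (mono_artinM (artin i)^-1%g (artin i)).
by rewrite mulVg mono11 (rmorphM to_hecke) (rmorph1 to_hecke).
Qed.

Lemma hecke_sK i : hecke_s i * hecke_sV i = 1.
Proof.
have := congr1 to_hecke (mono_artinM (artin i) (artin i)^-1%g).
by rewrite mulgV mono11 (rmorphM to_hecke) (rmorph1 to_hecke).
Qed.

Lemma hecke_far i j : (i.+1 < j)%N ->
  hecke_s i * hecke_s j = hecke_s j * hecke_s i.
Proof.
move=> ij.
suff /(congr1 to_hecke): braid_s i * braid_s j = braid_s j * braid_s i.
  by rewrite !(rmorphM to_hecke).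
rewrite !mono_artinM !braid_wordM; congr (mono _ _).
by apply/wordP/Conv_rel/Braid_far.
Qed.

Lemma hecke_near i j : j = i.+1 :> nat ->
  hecke_s i * hecke_s j * hecke_s i = hecke_s j * hecke_s i * hecke_s j.
Proof.
move=> ij.
suff /(congr1 to_hecke): braid_s i * braid_s j * braid_s i =
    braid_s j * braid_s i * braid_s j by rewrite !(rmorphM to_hecke).
rewrite !mono_artinM (braid_wordM [:: (i, false)] [:: (j, false)]).
rewrite (braid_wordM [:: (j, false)] [:: (i, false)]) !braid_wordM.
congr (mono _ _).
by apply/wordP/Conv_rel; apply: Braid_near.
Qed.

Lemma hecke_cubic i : (hecke_s i - scal par_a) * (hecke_s i - scal par_b) *
  (hecke_s i - scal par_c) = 0.
Proof.
suff: to_hecke ((braid_s i - scal par_a) * (braid_s i - scal par_b) *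
  (braid_s i - scal par_c)) = 0.
  by rewrite !(rmorphM to_hecke) !(rmorphB to_hecke).
rewrite -(rmorph0 to_hecke).
by apply/to_quotP; rewrite subr0; apply: Ideal_gen; exists i.
Qed.

End Hecke.

(** * Images of the Hecke relations *)

(** As abc is inverted in R, a (abc)^-1 is the inverse of y = bc. *)
Definition par_yV : ringR := par_a * loc_inv _.
Definition par_half : ringR := to_loc _ (2%:R^-1)%:MP.

Lemma par_yVK : par_yV * par_y = 1.
Proof.
rewrite /par_yV /par_y mulrC mulrA [_ * par_a]mulrC mulrA.
rewrite /par_a /par_b /par_c -!(rmorphM (to_loc _)); exact: loc_invP.
Qed.

Lemma par_halfK : par_half * 2%:R = 1.
Proof.
rewrite /par_half -(rmorph_nat (to_loc _)) -(rmorphM (to_loc _)).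
rewrite -(rmorph_nat (@mpolyC 3 rat)) -rmorphM /= mulVf ?pnatr_eq0 //.
Qed.

Section HeckeImage.
Variables (n : nat) (eps : bool).
Local Notation index := 'I_n.-1.
Local Notation K := (ringSpm eps).
Implicit Types i j : index.

Definition pm_eps : K := (-1) ^+ eps.
Definition pm_x : K := R_to_Spm eps par_x.
Definition pm_y : K := R_to_Spm eps par_y.
Definition pm_yV : K := R_to_Spm eps par_yV.

Lemma pm_epsK : pm_eps * pm_eps = 1.
Proof. by rewrite -expr2 sqrr_sign. Qed.

Lemma pm_xVK : pm_xV eps * pm_x = 1.
Proof.
rewrite mulrC -[LHS](rmorphM (S_to_Spm eps)).
by rewrite loc_invP (rmorph1 (S_to_Spm eps)).
Qed.

Lemma pm_yVK : pm_yV * pm_y = 1.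
Proof.
by rewrite -[LHS](rmorphM (R_to_Spm eps)) par_yVK (rmorph1 (R_to_Spm eps)).
Qed.

Lemma pm_aE : pm_a eps = pm_eps * pm_y.
Proof.
apply: subr0_eq.
have -> : pm_a eps - pm_eps * pm_y =
    S_to_Spm eps (R_to_S par_a - (-1) ^+ eps * R_to_S par_y).
  by rewrite (rmorphB (S_to_Spm eps)) (rmorphM (S_to_Spm eps)) rmorph_sign.
rewrite -(rmorph0 (S_to_Spm eps)); apply/to_quotP; rewrite subr0.
exact: Ideal_gen.
Qed.

Variables (C : pzRingType) (l : {rmorphism hecke3_pm n eps -> C}).
(** An arbitrary image [C] is considered because the relations are needed in two targets: [BMW_pm],
    and the reduction of the base-changed [BMW_bar] modulo a - eps y. *)
Definition scal_image : {rmorphism K -> C} :=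
  l \o (scal : {rmorphism K -> hecke3_pm n eps}).
Local Notation phi := scal_image.
Hypothesis phiC : forall k u, GRing.comm (phi k) u.

Let m : {rmorphism hecke3 n -> C} :=
  l \o to_base_change (R_to_Spm eps) (A := hecke3 n).
Let s i := l (hecke_pm_s eps i).
Let sV i := l (hecke_pm_sV eps i).

Let m_scal r : m (scal r) = phi (R_to_Spm eps r).
Proof. by rewrite /m /= to_base_change_scal. Qed.

Let sVs i : sV i * s i = 1.
Proof. by rewrite -[LHS](rmorphM m) hecke_sVK (rmorph1 m). Qed.
Let ssV i : s i * sV i = 1.
Proof. by rewrite -[LHS](rmorphM m) hecke_sK (rmorph1 m). Qed.

Lemma image_cubic_unit i : cubic_unit phi pm_eps pm_x pm_y (s i) (sV i).
Proof.
split=> //; rewrite -pm_aE /pm_a /pm_x /pm_y /par_x /par_y.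
rewrite (rmorphD (R_to_Spm eps)) (rmorphM (R_to_Spm eps)).
apply: (cubic_factor phiC); rewrite -!m_scal.
by have := congr1 m (hecke_cubic i); rewrite !(rmorphM m) !(rmorphB m) rmorph0.
Qed.

Lemma image_near i j : j = i.+1 :> nat -> s i * s j * s i = s j * s i * s j.
Proof. by move=> /hecke_near/(congr1 m); rewrite !(rmorphM m). Qed.

Lemma image_far i j : (i.+1 < j)%N -> s i * s j = s j * s i.
Proof. by move=> /hecke_far/(congr1 m); rewrite !(rmorphM m). Qed.

Lemma image_rel_R i j : l (to_base_change (R_to_Spm eps) (rel_R i j)) =
  braid_defect phi pm_x pm_y (s i) (sV i) (s j) (sV j).
Proof.
have -> : rel_R i j = braid_defect (scal : {rmorphism ringR -> hecke3 n})
    par_x par_y (hecke_s i) (hecke_sV i) (hecke_s j) (hecke_sV j) by [].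
exact: (braid_defect_morph (m := m)).
Qed.

(** With a = eps y, the sign factors out of the definition of e_i. *)
Lemma image_e i : l (hecke_pm_e eps i) =
  phi pm_eps * cup phi (pm_xV eps) pm_y (s i) (sV i).
Proof.
rewrite /hecke_pm_e pm_aE /cup.
have lsign : l ((-1) ^+ eps) = phi pm_eps by rewrite !rmorph_sign.
rewrite (rmorphB l) !(rmorphM l) (rmorphD l) !(rmorphM l) !lsign.
rewrite -![l (scal _)]/(phi _).
rewrite -!/(s i) -!/(sV i).
nc_ring phi phiC pm_epsK.
Qed.

Local Notation E i := (cup phi (pm_xV eps) pm_y (s i) (sV i)).
Local Notation e i := (l (hecke_pm_e eps i)).

Let e_diff i w : e i * w * e i - e i = E i * w * E i - phi pm_eps * E i.
Proof. rewrite image_e; nc_ring phi phiC pm_epsK. Qed.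

(** The product s_i s_j s_k conjugates s_i to s_j and s_j to s_k, which shifts the relation by one
    index. *)
Lemma image_conj i j (k : index) w : j = i.+1 :> nat -> k = j.+1 :> nat ->
  w = s \/ w = sV ->
  E i * w j * E i = phi pm_eps * E i -> E j * w k * E j = phi pm_eps * E j.
Proof.
move=> ij jk ws; pose g := s i * s j * s k.
have ik : (i.+1 < k)%N by rewrite jk ij.
have gi : g * s i = s j * g.
  by rewrite /g -!mulrA -(image_far ik) !mulrA (image_near ij).
have gj : g * s j = s k * g.
  by rewrite /g -!mulrA [s j * _]mulrA (image_near jk) !mulrA (image_far ik).
have giV : g * sV i = sV j * g := intertwine_inv (ssV i) (sVs j) gi.
have gjV : g * sV j = sV k * g := intertwine_inv (ssV j) (sVs k) gj.
have gK : g * (sV k * sV j * sV i) = 1.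
  by rewrite /g -!mulrA (mulrA (s k)) ssV mul1r (mulrA (s j)) ssV mul1r.
by apply: (cup_conj phiC pm_epsK gK gi giV); case: ws => ->.
Qed.

(** The relations are imposed on the first two generators only; [image_conj] propagates them, and
    [cup_defect] then applies to every i. *)
Lemma image_e_defect :
  (forall i j, i = 0 :> nat -> j = 1 :> nat -> e i * s j * e i = e i) ->
  (forall i j, i = 0 :> nat -> j = 1 :> nat -> e i * sV j * e i = e i) ->
  forall i j, j = i.+1 :> nat ->
  l (to_base_change (R_to_Spm eps) (rel_R i j)) = 0.
Proof.
move=> e0 e0V i j ij; rewrite image_rel_R.
have cupE w : w = s \/ w = sV ->
    (forall i j, i = 0 :> nat -> j = 1 :> nat -> e i * w j * e i = e i) ->
    E i * w j * E i = phi pm_eps * E i.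
  (* Induction on the value of the index [i], with [i] and [j] generalized. *)
  move=> ws w0; have [k ik] : exists k, i = k :> nat by exists i.
  elim: k => [|k IHk] in i j ij ik *.
    by apply: subr0_eq; rewrite -e_diff w0 ?subrr // ij ik.
  have kn : (k < n.-1)%N by apply: ltnW; rewrite -ik.
  apply: (image_conj (i := Ordinal kn)) => //.
  exact: IHk.
apply: (cup_defect phiC pm_epsK pm_xVK); try exact: image_cubic_unit.
- exact: image_near.
- by apply: cupE; [left|].
- by apply: cupE; [right|].
Qed.

(** By [defect_cup_inv] the two relations have the same left-hand side, so [defect_cup] settles
    both. *)
Lemma image_defect_e i j : j = i.+1 :> nat ->
  l (to_base_change (R_to_Spm eps) (rel_R i j)) = 0 ->
  phi (pm_y - 1) * (e i * s j * e i - e i) = 0 /\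
  phi (pm_y - 1) * (e i * sV j * e i - e i) = 0.
Proof.
rewrite image_rel_R => ij R0.
have si := image_cubic_unit i; have sj := image_cubic_unit j.
rewrite !e_diff -(defect_cup_inv phiC pm_epsK pm_xVK pm_yVK si sj) //.
  by split; apply: (defect_cup phiC pm_epsK pm_xVK pm_yVK si sj) => //;
    exact: image_near.
exact: image_near.
Qed.

End HeckeImage.

(** * The comparison morphism *)

Section Comparison.
Variable n : nat.

Section ToPm.
Variable eps : bool.

Definition hecke_pm_to_pm : {rmorphism hecke3_pm n eps -> BMW_pm n eps} :=
  to_quot _.

Fact hecke_to_pm_subproof u :
  (exists i j : 'I_n.-1, j = i.+1 :> nat /\ u = rel_R i j) ->
  (hecke_pm_to_pm \o to_base_change (R_to_Spm eps) (A := hecke3 n)) u = 0.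
Proof.
case=> i [j [ij ->]].
apply: (image_e_defect (l := hecke_pm_to_pm)) ij
  => [k u'|i' j' i0 j1|i' j' i0 j1].
- exact: (@scalC _ (BMW_pm n eps)).
- rewrite -(rmorphM _ (hecke_pm_e eps i')) -(rmorphM _ (_ * _)).
  apply/to_quotP; apply: Ideal_gen.
  by exists i', j'; split=> //; left.
- rewrite -(rmorphM _ (hecke_pm_e eps i')) -(rmorphM _ (_ * _)).
  apply/to_quotP; apply: Ideal_gen.
  by exists i', j'; split=> //; right.
Qed.

Definition tilde_to_pm : {rmorphism BMW_tilde n -> BMW_pm n eps} :=
  quot_lift hecke_to_pm_subproof.

Lemma tilde_to_pmE u : tilde_to_pm (to_quot _ u) =
  hecke_pm_to_pm (to_base_change (R_to_Spm eps) u).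
Proof. exact: quot_liftE. Qed.

Lemma Rbar_to_SpmE r : Rbar_to_Spm eps (R_to_Rbar r) = R_to_Spm eps r.
Proof. exact: quot_liftE. Qed.

Definition Rbar_to_pm : {rmorphism ringRbar -> BMW_pm n eps} :=
  (scal : {rmorphism ringSpm eps -> BMW_pm n eps}) \o Rbar_to_Spm eps.

Fact bar_to_pm_comm (u : BMW_tilde n) r :
  GRing.comm (tilde_to_pm u) (Rbar_to_pm r).
Proof. exact/commr_sym/(@scalC _ (BMW_pm n eps)). Qed.

Fact bar_to_pm_scal r : tilde_to_pm (scal r) = Rbar_to_pm (R_to_Rbar r).
Proof.
rewrite -[RHS]/(scal (Rbar_to_Spm eps (R_to_Rbar r))) Rbar_to_SpmE.
rewrite -[scal r]/(to_quot _ (scal r)).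
by rewrite tilde_to_pmE to_base_change_scal.
Qed.

Definition bar_to_pm : {rmorphism BMW_bar n -> BMW_pm n eps} :=
  base_change_lift bar_to_pm_comm bar_to_pm_scal.

Lemma bar_to_pm_to u : bar_to_pm (to_base_change R_to_Rbar (to_quot _ u)) =
  hecke_pm_to_pm (to_base_change (R_to_Spm eps) u).
Proof. by rewrite [LHS]base_change_lift_to tilde_to_pmE. Qed.

Lemma bar_to_pm_scalar r : bar_to_pm (scal r) = scal (Rbar_to_Spm eps r).
Proof. exact: base_change_lift_scal. Qed.

End ToPm.

Definition bar_to_sum (z : BMW_bar n) : BMW_sum n :=
  (bar_to_pm false z, bar_to_pm true z).

Fact bar_to_sum_zmod_morphism : zmod_morphism bar_to_sum.
Proof. by move=> u v; congr pair; exact: rmorphB. Qed.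
Fact bar_to_sum_monoid_morphism : monoid_morphism bar_to_sum.
Proof.
by split=> [|u v]; congr pair; by [exact: rmorph1 | exact: rmorphM].
Qed.
HB.instance Definition _ := GRing.isZmodMorphism.Build
  (BMW_bar n) (BMW_sum n) bar_to_sum bar_to_sum_zmod_morphism.
HB.instance Definition _ := GRing.isMonoidMorphism.Build
  (BMW_bar n) (BMW_sum n) bar_to_sum bar_to_sum_monoid_morphism.

Fact bar_to_sum_scal r : bar_to_sum (scal r) = scal r.
Proof. by congr pair; exact: bar_to_pm_scalar. Qed.
HB.instance Definition _ := isAlgMorphism.Build ringRbar
  (BMW_bar n) (BMW_sum n) bar_to_sum bar_to_sum_scal.

Lemma bar_to_sum_s i :
  bar_to_sum (BMW_bar_s i) = (BMW_pm_s false i, BMW_pm_s true i).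
Proof. by congr pair; exact: bar_to_pm_to. Qed.

End Comparison.

(** * Surjectivity *)

Lemma fracE (A : comPzRingType) (f u : A) k :
  Defs.frac f u k = to_loc f u * loc_inv f ^+ k.
Proof.
elim: k => [|k IHk]; first by rewrite mulr1.
rewrite exprSr mulrA -IHk -[RHS]/(loc_mul _ _) frac_mul.
by rewrite mulr1 addn1.
Qed.

(** [ringSpm] is a quotient of R[x^-1], where every element is a fraction. *)
Lemma ringSpm_frac eps (b : ringSpm eps) :
  exists r k, b = R_to_Spm eps r * pm_xV eps ^+ k.
Proof.
have -> : b = S_to_Spm eps (quot_repr b) by rewrite [RHS]quot_reprK.
elim/locW: (quot_repr b) => r k; exists r, k.
by rewrite fracE (rmorphM (S_to_Spm eps)) (rmorphXn (S_to_Spm eps)).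
Qed.

Definition S_to_Sbar' : {rmorphism ringS -> ringSbar'} :=
  to_loc (R_to_Sbar (par_b * par_c - 1)) \o
    (to_quot _ : {rmorphism ringS -> ringSbar}).

Definition R_to_Sbar' : {rmorphism ringR -> ringSbar'} :=
  S_to_Sbar' \o R_to_S.

Lemma Rbar_to_Sbar'E r : Rbar_to_Sbar' (R_to_Rbar r) = R_to_Sbar' r.
Proof.
have e : Rbar_to_Sbar (R_to_Rbar r) = R_to_Sbar r by exact: quot_liftE.
by rewrite -[LHS]/(to_loc _ (Rbar_to_Sbar (R_to_Rbar r))) e.
Qed.

(** The inverse of 2y = (a + y) - (a - y), the unit that separates the two signs. *)
Definition two_yV : ringSbar' := R_to_Sbar' (par_half * par_yV).

Lemma two_yVK : two_yV * R_to_Sbar' (2%:R * par_y) = 1.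
Proof.
rewrite /two_yV -[LHS](rmorphM R_to_Sbar') mulrACA par_halfK par_yVK mul1r.
exact: (rmorph1 R_to_Sbar').
Qed.

Definition Sbar'_xV : ringSbar' := S_to_Sbar' (loc_inv par_x).

Lemma Sbar'_xVK : Sbar'_xV * R_to_Sbar' par_x = 1.
Proof.
by rewrite mulrC -[LHS](rmorphM S_to_Sbar') loc_invP (rmorph1 S_to_Sbar').
Qed.

Section Surjective.
Variable n : nat.
Local Notation T := (base_change Rbar_to_Sbar' (BMW_bar n)).
Local Notation U := (base_change Rbar_to_Sbar' (BMW_sum n)).
Local Notation Phi := (base_change_map Rbar_to_Sbar'
  (bar_to_sum (n := n) : {pzalg BMW_bar n -> BMW_sum n})).

Definition in_image (z : U) := exists w : T, Phi w = z.
Local Notation iota := (to_base_change Rbar_to_Sbar' (A := BMW_sum n)).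

Lemma bar_to_sum_changeE w b :
  Phi (to_base_change Rbar_to_Sbar' w * scal b) = iota (bar_to_sum w) * scal b.
Proof. by rewrite -!tensorE [LHS]base_change_mapE. Qed.

Lemma bar_to_sum_change_to w :
  Phi (to_base_change Rbar_to_Sbar' w) = iota (bar_to_sum w).
Proof. by have := bar_to_sum_changeE w 1; rewrite !rmorph1 !mulr1. Qed.

Lemma in_imageD z t : in_image z -> in_image t -> in_image (z + t).
Proof. by move=> [v <-] [w <-]; exists (v + w); rewrite rmorphD. Qed.

Lemma in_imageM z t : in_image z -> in_image t -> in_image (z * t).
Proof. by move=> [v <-] [w <-]; exists (v * w); rewrite rmorphM. Qed.

Lemma in_image_scal b : in_image (scal b).
Proof. by exists (scal b); exact: alg_morphism_scal. Qed.

Lemma in_image_cancel (b c : ringSbar') z : b * c = 1 ->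
  in_image (scal c * z) -> in_image z.
Proof.
move=> bc Iz.
rewrite -[z]mul1r -(rmorph1 (scal : {rmorphism ringSbar' -> U})) -bc.
by rewrite rmorphM -mulrA; apply: in_imageM Iz; exact: in_image_scal.
Qed.

(** * Each factor lies in the image *)

Section Summand.
Variable eps : bool.

(** Extension by zero, compatible with sums and products; [summand 1] is the idempotent of the
    factor. The match is dependent because the type of [u] varies with the sign. *)
Definition summand (u : BMW_pm n eps) : BMW_sum n :=
  (if eps as e return BMW_pm n e -> BMW_sum n
   then fun v => (0, v) else fun v => (v, 0)) u.

Lemma summand0 : summand 0 = 0.
Proof. by rewrite /summand; case: eps. Qed.

Lemma summandD u v : summand (u + v) = summand u + summand v.
Proof.
by rewrite /summand; case: eps u v => u v; congr pair; rewrite /= addr0.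
Qed.

Lemma summandM u v : summand (u * v) = summand u * summand v.
Proof.
by rewrite /summand; case: eps u v => u v; congr pair; rewrite /= mulr0.
Qed.

Lemma summand_bar w : summand (bar_to_pm n eps w) = bar_to_sum w * summand 1.
Proof.
by rewrite /summand; case: eps; congr pair; rewrite /= ?mulr0 ?mulr1.
Qed.

Lemma summand_scal r u :
  summand (scal (Rbar_to_Spm eps r) * u) = scal r * summand u.
Proof.
by rewrite /summand; case: eps u => u; congr pair; rewrite /= mulr0.
Qed.

(** Up to the unit 2y, the idempotent is a scalar coming from [ringRbar]. *)
Lemma summand_unit : in_image (iota (summand 1)).
Proof.
apply: (in_image_cancel two_yVK).
rewrite -Rbar_to_Sbar'E -to_base_change_scal -rmorphM.
set r := R_to_Rbar _.
(* As a is y in the plus factor and -y in the minus factor, [q] is 2y in the factor of sign [eps]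
   and 0 in the other. *)
pose q := R_to_Rbar (par_y + (-1) ^+ eps * par_a).
suff -> : scal r * summand 1 = scal q.
  exists (to_base_change _ (scal q)).
  by rewrite bar_to_sum_change_to bar_to_sum_scal.
have qE e : Rbar_to_Spm e q = pm_y e + (-1) ^+ eps * ((-1) ^+ e * pm_y e).
  rewrite Rbar_to_SpmE (rmorphD (R_to_Spm e)).
  rewrite (rmorphM (R_to_Spm e) ((-1) ^+ eps)) (rmorph_sign (R_to_Spm e)).
  by congr (_ + _ * _); exact: pm_aE.
have q_eps : Rbar_to_Spm eps q = Rbar_to_Spm eps r.
  rewrite qE signrMK Rbar_to_SpmE (rmorphM (R_to_Spm eps) 2%:R).
  by rewrite (rmorph_nat (R_to_Spm eps)) mulr_natl mulr2n.
have q_neps : Rbar_to_Spm (~~ eps) q = 0.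
  by rewrite qE signrN mulNr mulrN signrMK subrr.
have -> : scal q = (scal (Rbar_to_Spm false q), scal (Rbar_to_Spm true q))
  :> BMW_sum n by [].
rewrite /summand; clear qE; clearbody q r; case: eps q_eps q_neps => -> ->;
  rewrite rmorph0; congr pair; by [exact: mulr0 | exact: mulr1].
Qed.

(** The factor is generated by the image of [BMW_bar] and by x^-1, and x is invertible in
    [ringSbar']. *)
Lemma summand_image u : in_image (iota (summand u)).
Proof.
have IM v w : in_image (iota (summand v)) -> in_image (iota (summand w)) ->
    in_image (iota (summand (v * w))).
  by rewrite summandM rmorphM; exact: in_imageM.
have Ibar w : in_image (iota (summand (bar_to_pm n eps w))).
  rewrite summand_bar rmorphM; apply: in_imageM summand_unit.
  by exists (to_base_change _ w); exact: bar_to_sum_change_to.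
have IxV : in_image (iota (summand (scal (pm_xV eps)))).
  apply: (in_image_cancel Sbar'_xVK).
  rewrite -Rbar_to_Sbar'E -to_base_change_scal -rmorphM -summand_scal.
  rewrite Rbar_to_SpmE -rmorphM mulrC pm_xVK rmorph1.
  exact: summand_unit.
have -> : u = hecke_pm_to_pm n eps (quot_repr u) by rewrite [RHS]quot_reprK.
elim/base_change_ind: (quot_repr u) => [|z t Iz It|h b].
- by exists 0; rewrite (rmorph0 (hecke_pm_to_pm n eps)) summand0 !rmorph0.
- by rewrite rmorphD summandD rmorphD; exact: in_imageD.
rewrite rmorphM; apply: (IM).
  have := Ibar (to_base_change R_to_Rbar (to_quot _ h)).
  by rewrite bar_to_pm_to.
rewrite [hecke_pm_to_pm _ _ _]to_quot_scal.
have [r [k ->]] := ringSpm_frac b; rewrite rmorphM; apply: (IM).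
  have := Ibar (scal (R_to_Rbar r)).
  by rewrite bar_to_pm_scalar Rbar_to_SpmE.
elim: k => [|k IHk]; first by rewrite expr0 rmorph1; exact: summand_unit.
by rewrite exprS rmorphM; exact: IM.
Qed.

End Summand.

Lemma bar_to_sum_change_surj z : in_image z.
Proof.
elim/base_change_ind: z => [|z t|[u v] b]; first by exists 0; rewrite rmorph0.
  exact: in_imageD.
apply: in_imageM (in_image_scal b).
have -> : (u, v) = summand (eps := false) u + summand (eps := true) v.
  by congr pair; rewrite /= ?addr0 ?add0r.
by rewrite rmorphD; apply: in_imageD; exact: summand_image.
Qed.

End Surjective.

(** * Injectivity *)

Section Injective.
Variable n : nat.
Local Notation T := (base_change Rbar_to_Sbar' (BMW_bar n)).
Local Notation U := (base_change Rbar_to_Sbar' (BMW_sum n)).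
Local Notation Phi := (base_change_map Rbar_to_Sbar'
  (bar_to_sum (n := n) : {pzalg BMW_bar n -> BMW_sum n})).

Definition sign_defect (eps : bool) : ringSbar' :=
  R_to_Sbar' par_a - (-1) ^+ eps * R_to_Sbar' par_y.

(** * Reduction modulo a - eps y and the map back from [BMW_pm] *)

Section Component.
Variable eps : bool.

Definition component : pzAlgType ringSbar' :=
  quot (fun z : T => z = scal (sign_defect eps)).

Definition to_component : {rmorphism T -> component} := to_quot _.

Lemma component_scalC b (u : component) : GRing.comm (to_component (scal b)) u.
Proof. exact: (@scalC _ component). Qed.

Definition S_to_component : {rmorphism ringS -> component} :=
  (to_component \o (scal : {rmorphism ringSbar' -> T})) \o S_to_Sbar'.

Fact Spm_to_component_subproof u :
  u = R_to_S par_a - (-1) ^+ eps * R_to_S par_y -> S_to_component u = 0.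
Proof.
move=> ->; have e : S_to_Sbar' (R_to_S par_a - (-1) ^+ eps * R_to_S par_y) =
    sign_defect eps.
  by rewrite (rmorphB S_to_Sbar') (rmorphM S_to_Sbar') (rmorph_sign S_to_Sbar').
rewrite -[LHS]/(to_component (scal (S_to_Sbar' _))) e -(rmorph0 to_component).
by apply/to_quotP; rewrite subr0; exact: Ideal_gen.
Qed.

Definition Spm_to_component : {rmorphism ringSpm eps -> component} :=
  quot_lift Spm_to_component_subproof.

Lemma Spm_to_componentE u :
  Spm_to_component (S_to_Spm eps u) = to_component (scal (S_to_Sbar' u)).
Proof. exact: quot_liftE. Qed.

Lemma Spm_to_component_comm k u : GRing.comm (Spm_to_component k) u.
Proof.
have -> : k = S_to_Spm eps (quot_repr k) by rewrite [RHS]quot_reprK.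
rewrite Spm_to_componentE; exact: component_scalC.
Qed.

Definition hecke_to_component : {rmorphism hecke3 n -> component} :=
  ((to_component \o to_base_change Rbar_to_Sbar' (A := BMW_bar n)) \o
   to_base_change R_to_Rbar (A := BMW_tilde n)) \o
   (to_quot _ : {rmorphism hecke3 n -> BMW_tilde n}).

Fact hecke_to_component_comm u k :
  GRing.comm (hecke_to_component u) (Spm_to_component k).
Proof. exact/commr_sym/Spm_to_component_comm. Qed.

Fact hecke_to_component_scal r :
  hecke_to_component (scal r) = Spm_to_component (R_to_Spm eps r).
Proof.
rewrite [RHS]Spm_to_componentE -[S_to_Sbar' _]/(R_to_Sbar' r) -Rbar_to_Sbar'E.
rewrite -to_base_change_scal -[LHS]/(to_component (to_base_change _
  (to_base_change R_to_Rbar (scal r : BMW_tilde n)))).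
by rewrite to_base_change_scal.
Qed.

Definition hecke_pm_to_component : {rmorphism hecke3_pm n eps -> component} :=
  base_change_lift hecke_to_component_comm hecke_to_component_scal.

Lemma hecke_pm_to_component_scal k :
  hecke_pm_to_component (scal k) = Spm_to_component k.
Proof. exact: base_change_lift_scal. Qed.

Lemma hecke_pm_to_component_to u :
  hecke_pm_to_component (to_base_change _ u) = hecke_to_component u.
Proof. exact: base_change_lift_to. Qed.

(** The image of y - 1 is a unit because bc - 1 is inverted in [ringSbar']. *)
Lemma component_cancel (u : component) :
  hecke_pm_to_component (scal (pm_y eps - 1)) * u = 0 -> u = 0.
Proof.
pose v := to_component (scal (loc_inv (R_to_Sbar (par_b * par_c - 1)))).
move=> yu; rewrite -[u]mul1r.
suff <- : v * hecke_pm_to_component (scal (pm_y eps - 1)) = 1.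
  by rewrite -mulrA yu mulr0.
rewrite hecke_pm_to_component_scal.
have -> : pm_y eps - 1 = S_to_Spm eps (R_to_S (par_b * par_c - 1)).
  by rewrite (rmorphB R_to_S) (rmorphB (S_to_Spm eps)) !rmorph1.
rewrite Spm_to_componentE -(rmorphM to_component).
rewrite -(rmorphM (scal : {rmorphism ringSbar' -> T})) mulrC loc_invP.
by rewrite !rmorph1.
Qed.

(** R_i already vanishes in [BMW_tilde], so [image_defect_e] gives the relations up to the factor y
    - 1, which [component_cancel] removes. *)
Fact pm_to_component_subproof u :
  (exists i j : 'I_n.-1, [/\ i = 0 :> nat, j = 1 :> nat &
    let e := hecke_pm_e eps i in
    u = e * hecke_pm_s eps j * e - e \/ u = e * hecke_pm_sV eps j * e - e]) ->
  hecke_pm_to_component u = 0.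
Proof.
case=> i [j [i0 j1 /= u_e]].
have R0 : hecke_pm_to_component
    (to_base_change (R_to_Spm eps) (rel_R i j)) = 0.
  rewrite hecke_pm_to_component_to.
  have e : to_quot _ (rel_R i j) = 0 :> BMW_tilde n.
    rewrite -(rmorph0 (to_quot _)); apply/to_quotP; rewrite subr0.
    by apply: Ideal_gen; exists i, j; rewrite i0 j1.
  by rewrite -[LHS]/(to_component (to_base_change _
    (to_base_change R_to_Rbar (to_quot _ (rel_R i j))))) e !rmorph0.
have lC k v : GRing.comm (scal_image hecke_pm_to_component k) v.
  rewrite -[scal_image _ _]/(hecke_pm_to_component (scal k)).
  by rewrite hecke_pm_to_component_scal; exact: Spm_to_component_comm.
have ij : j = i.+1 :> nat by rewrite i0 j1.
have [e1 e2] := image_defect_e lC ij R0.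
apply: component_cancel.
move: (hecke_pm_e eps i) (hecke_pm_s eps j) (hecke_pm_sV eps j) u_e e1 e2.
move=> e s sV u_e e1 e2; case: u_e => ->;
  rewrite (rmorphB hecke_pm_to_component) !(rmorphM hecke_pm_to_component).
- exact: e1.
- exact: e2.
Qed.

Definition pm_to_component : {rmorphism BMW_pm n eps -> component} :=
  quot_lift pm_to_component_subproof.

Lemma pm_to_componentE u :
  pm_to_component (hecke_pm_to_pm n eps u) = hecke_pm_to_component u.
Proof. exact: quot_liftE. Qed.

Lemma pm_to_component_scal r :
  pm_to_component (scal (Rbar_to_Spm eps r)) =
  to_component (scal (Rbar_to_Sbar' r)).
Proof.
have -> : r = R_to_Rbar (quot_repr r) by rewrite [RHS]quot_reprK.
rewrite Rbar_to_SpmE Rbar_to_Sbar'E.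
rewrite -[scal (R_to_Spm eps _)]/(hecke_pm_to_pm n eps (scal _)).
by rewrite pm_to_componentE hecke_pm_to_component_scal [LHS]Spm_to_componentE.
Qed.

Lemma pm_to_component_bar w : pm_to_component (bar_to_pm n eps w) =
  to_component (to_base_change Rbar_to_Sbar' w).
Proof.
elim/base_change_ind: w => [|z t ez et|v r].
- by rewrite !rmorph0.
- by rewrite !rmorphD ez et.
rewrite !rmorphM bar_to_pm_scalar pm_to_component_scal.
congr (_ * _); last first.
  by congr (to_component _); apply/esym; exact: to_base_change_scal.
have -> : v = to_quot _ (quot_repr v) by rewrite [RHS]quot_reprK.
by rewrite bar_to_pm_to pm_to_componentE hecke_pm_to_component_to.
Qed.

Variable p : {rmorphism BMW_sum n -> BMW_pm n eps}.
Hypothesis p_bar : forall w, p (bar_to_sum w) = bar_to_pm n eps w.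
Hypothesis p_scal : forall r, p (scal r) = scal (Rbar_to_Spm eps r).

Let q : {rmorphism BMW_sum n -> component} := pm_to_component \o p.
Let g : {rmorphism ringSbar' -> component} :=
  to_component \o (scal : {rmorphism ringSbar' -> T}).

Fact sum_to_component_comm u b : GRing.comm (q u) (g b).
Proof. exact/commr_sym/component_scalC. Qed.

Fact sum_to_component_scal r : q (scal r) = g (Rbar_to_Sbar' r).
Proof.
by rewrite -[LHS]/(pm_to_component (p (scal r))) p_scal pm_to_component_scal.
Qed.

(** Going to a factor and back is reduction modulo a - eps y, by [pm_to_component_bar]. The
    projection [p] stands for [fst] or [snd] according to the sign. *)
Lemma sum_to_componentE z :
  base_change_lift sum_to_component_comm sum_to_component_scal (Phi z) =
  to_component z.
Proof.
elim/base_change_ind: z => [|z t ez et|w b]; rewrite ?rmorph0 //.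
  rewrite (rmorphD to_component) -ez -et -[RHS]rmorphD.
  by congr (base_change_lift _ _ _); exact: rmorphD.
rewrite bar_to_sum_changeE -tensorE base_change_liftE.
rewrite -[q _]/(pm_to_component (p _)) p_bar pm_to_component_bar.
by rewrite rmorphM.
Qed.

(** By [sum_to_componentE] such a z dies in [component], the quotient by a central element. *)
Lemma component_ker z : Phi z = 0 -> exists w, z = scal (sign_defect eps) * w.
Proof.
move=> z0; apply: central_ideal; first exact: scalC.
suff : to_component z = to_component 0 by move/to_quotP; rewrite subr0.
by rewrite -sum_to_componentE z0 !rmorph0.
Qed.

End Component.

Lemma sign_defectM : sign_defect false * sign_defect true = 0.
Proof.
have a2 : R_to_Sbar' par_a ^+ 2 - R_to_Sbar' par_y ^+ 2 = 0.
  rewrite -!(rmorphXn R_to_Sbar') -(rmorphB R_to_Sbar') -Rbar_to_Sbar'E.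
  suff -> : R_to_Rbar (par_a ^+ 2 - par_y ^+ 2) = 0 by rewrite rmorph0.
  rewrite -(rmorph0 R_to_Rbar); apply/to_quotP; rewrite subr0.
  exact: Ideal_gen.
by rewrite /sign_defect expr0 expr1 mul1r mulN1r opprK -subr_sqr.
Qed.

Lemma sign_defectB : sign_defect true - sign_defect false =
  R_to_Sbar' (2%:R * par_y).
Proof.
rewrite /sign_defect (rmorphM R_to_Sbar' 2%:R) (rmorph_nat R_to_Sbar').
by ring.
Qed.

(** An element of the kernel is a multiple of a - y and of a + y. Their product is 0, so both
    annihilate it, and hence so does their difference, the unit 2y. *)
Lemma bar_to_sum_change_inj : injective Phi.
Proof.
move=> z t /eqP; rewrite -subr_eq0 -rmorphB => /eqP zt0.
apply: subr0_eq; move: (z - t) zt0 => {}z z0.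
have [v zv] := component_ker
  (p := fst : {rmorphism BMW_sum n -> BMW_pm n false})
  (fun=> erefl) (fun=> erefl) z0.
have [w zw] := component_ker
  (p := snd : {rmorphism BMW_sum n -> BMW_pm n true})
  (fun=> erefl) (fun=> erefl) z0.
pose sc : {rmorphism ringSbar' -> T} := scal.
have e1 : sc (sign_defect true) * z = 0.
  by rewrite zv mulrA -(rmorphM sc) mulrC sign_defectM rmorph0 mul0r.
have e2 : sc (sign_defect false) * z = 0.
  by rewrite zw mulrA -(rmorphM sc) sign_defectM rmorph0 mul0r.
rewrite -[z]mul1r -(rmorph1 sc) -two_yVK -sign_defectB (rmorphM sc).
by rewrite (rmorphB sc) -mulrA mulrBl e1 e2 subrr mulr0.
Qed.

End Injective.

Theorem proposition4p5 (n : nat) :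
  exists f : {pzalg BMW_bar n -> BMW_sum n},
    (forall i : 'I_n.-1,
       f (BMW_bar_s i) = (BMW_pm_s false i, BMW_pm_s true i)) /\
    bijective (base_change_map Rbar_to_Sbar' f).
Proof.
exists (bar_to_sum (n := n)); split; first exact: bar_to_sum_s.
have surj := bar_to_sum_change_surj (n := n).
(* The inverse chooses a preimage; injectivity makes it two-sided. *)
exists (fun z => projT1 (cid (surj z))) => z.
  by apply: bar_to_sum_change_inj; case: cid.
by case: cid.
Qed.
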